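(* Let $\Omega\subset\mathbb{R}^N$ be a bounded domain, let $f$ satisfy (f1) and (f3), and let $u$ be the solution of $\inf\{\mathcal{I}_\Omega(v): v\in W^{1,\infty}_0(\Omega)\}$. Then $u\equiv0$ if and only if $f'(0)\,h(\Omega)\ge1$.
   Context: $\mathcal{I}_\Omega(v)=\int_\Omega [f(|Dv|)-v]\,dx$. The Cheeger constant of $\Omega$ is $h(\Omega)=\inf\Big\{\frac{\int_\Omega|D\phi|\,dx}{\int_\Omega|\phi|\,dx}:\ \phi\in C^1_0(\Omega),\ \phi\not\equiv0\Big\}$. (f1) $f\in C^1([0,\infty))$ is convex, monotone nondecreasing, $f(0)=0$ and $\lim_{s\to\infty}f(s)/s=+\infty$; (f3) $f'(0)>0$, $f\in C^{2,\alpha}(0,\infty)$ for some $0<\alpha<1$, and $f''(s)>0$ for every $s>0$. *)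

(* Defs.v *)
From HB Require Import structures.
From mathcomp Require Import all_boot all_order all_algebra.
From mathcomp Require Import all_classical all_reals all_analysis.
Set Implicit Arguments. Unset Strict Implicit. Unset Printing Implicit Defensive.
Import Order.TTheory GRing.Theory Num.Theory.
Import numFieldNormedType.Exports.
Local Open Scope classical_set_scope.
Local Open Scope ring_scope.

Definition enorm (R : realType) (N : nat) (x : 'rV[R]_N) : R :=
  Num.sqrt (\sum_(i < N) x 0 i ^+ 2).

(* Lebesgue integral on R^N, defined as the iterated one-dimensional Lebesgue
   integral (Fubini–Tonelli). *)
Fixpoint iint (R : realType) (n : nat) : ('rV[R]_n -> \bar R) -> \bar R :=
  match n return ('rV[R]_n -> \bar R) -> \bar R with
  | 0 => fun g => g 0
  | n'.+1 => fun g =>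
      (\int[@lebesgue_measure R]_(t in [set: R])
          iint (fun y : 'rV[R]_n' => g (row_mx (\row_(j < 1) t) y)))%E
  end.

Definition integral_on (R : realType) (N : nat) (Omega : set 'rV[R]_N)
  (g : 'rV[R]_N -> R) : \bar R :=
  iint (fun x => (if `[< Omega x >] then g x else 0)%:E).

Definition partial (R : realType) (N : nat) (v : 'rV[R]_N -> R) (i : 'I_N)
  (x : 'rV[R]_N) : R := 'd v x (delta_mx 0 i).

(* |Dv|(x): Euclidean norm of the gradient where v is differentiable, 0
   elsewhere (for Lipschitz v this is a null set, by Rademacher). *)
Definition gradnorm (R : realType) (N : nat) (v : 'rV[R]_N -> R)
  (x : 'rV[R]_N) : R :=
  if `[< differentiable v x >] then enorm (\row_i partial v i x) else 0.

Definition lipschitz_fun (R : realType) (N : nat) (v : 'rV[R]_N -> R) :=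
  exists L : R, forall x y, `|v x - v y| <= L * enorm (x - y).

(* W^{1,infty}_0(Omega): Lipschitz functions on R^N vanishing outside Omega
   (= Lipschitz functions on the closure of Omega vanishing on its boundary,
   extended by zero). *)
Definition W1inf0 (R : realType) (N : nat) (Omega : set 'rV[R]_N)
  (v : 'rV[R]_N -> R) :=
  lipschitz_fun v /\ (forall x, ~ Omega x -> v x = 0).

Definition C10 (R : realType) (N : nat) (Omega : set 'rV[R]_N)
  (phi : 'rV[R]_N -> R) :=
  (forall x, differentiable phi x) /\
  (forall i, continuous (partial phi i)) /\
  exists K : set 'rV[R]_N, compact K /\ K `<=` Omega /\
     (forall x, ~ K x -> phi x = 0).

Definition I_Omega (R : realType) (N : nat) (f : R -> R)
  (Omega : set 'rV[R]_N) (v : 'rV[R]_N -> R) : \bar R :=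
  integral_on Omega (fun x => f (gradnorm v x) - v x).

Definition cheeger (R : realType) (N : nat) (Omega : set 'rV[R]_N) : \bar R :=
  ereal_inf [set ((fine (integral_on Omega (gradnorm phi)) /
                   fine (integral_on Omega (fun x => `|phi x|)))%:E)%E
            | phi in [set phi | C10 Omega phi /\ exists x, phi x != 0]].

Definition bounded_domain (R : realType) (N : nat) (Omega : set 'rV[R]_N) :=
  open Omega /\ connected Omega /\ Omega !=set0 /\
  exists M : R, forall x, Omega x -> enorm x <= M.

(* Main.v *)
(* Write h for the Cheeger constant. If u = 0, the energy is nonnegative; testing
   it on t |phi| with phi in C^1_0 and letting t tend to 0 gives
   int |phi| <= f'(0) int |D phi|, i.e. f'(0) h >= 1. Conversely f'(0) h >= 1 gives
   this inequality on C^1_0, and mollifying the truncations (v - d)^+ extends it to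
   int v^+ <= f'(0) int |Dv| for v in W^{1,oo}_0. With v = u and I(u) <= I(0) = 0
   one gets int (f(|Du|) - f'(0) |Du|) <= 0, and f(s) > f'(0) s for s > 0 forces
   Du = 0 almost everywhere; the inequality for u and - u then gives u = 0.

   Mollification needs Rademacher's theorem, which is proved by induction on the
   dimension from its one-dimensional case (Radon-Nikodym for a Stieltjes measure
   and Lebesgue differentiation). Given that the slices u(t, _) are differentiable
   at y for almost every t, cover these t by countably many sets A on which the
   linear approximation at (t, y) in the direction of y is uniform. The distance
   to A is Lipschitz, hence differentiable with zero derivative at almost every
   point of A: t + s is o(s)-close to A, and the increment of u along y can be
   computed there. *)
Require Import Defs.
From HB Require Import structures.
From mathcomp Require Import all_boot all_order all_algebra.
From mathcomp Require Import all_classical all_reals all_analysis measurable_realfun.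
From mathcomp Require Import ring lra.
Set Implicit Arguments. Unset Strict Implicit. Unset Printing Implicit Defensive.
Import Order.TTheory GRing.Theory Num.Theory.
Import numFieldNormedType.Exports.
Local Open Scope classical_set_scope.
Local Open Scope ring_scope.

(** Two conventions in the definitions shape the proof. Integrals are iterated one-dimensional ones,
    and agree with an integral for a product measure only where Fubini's theorem applies; the
    functions that occur are therefore kept in a class [bfun], on which the real number [J g] is the
    integral. Moreover [gradnorm] is 0 where the function is not differentiable, so the integral of
    [gradnorm v] controls nothing until [v] is known to be differentiable almost everywhere. That
    knowledge enters when difference quotients pass to the limit under the integral defining the
    mollification.

    Truncating at height [d] before mollifying makes room: if [v] has Lipschitz constant [L] and the
    kernel has radius [r] with [L r <= d / 2], the result is supported where [v >= d / 2], a compact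
    subset of [Omega]. The truncation only sees the positive part, which is why [u] and [- u] are
    treated in turn.

    The limit for small [t] requires no limit theorem: convexity and [f 0 = 0] give
    [f (a h) <= a f(h)] for [a] in [[0, 1]], so one small [h] controls all the values of the
    gradient at once. *)

(** * Lebesgue measure on R^n *)

(* The library equips [m1 \x m2] with a sigma-finite structure only when [m1] and
   [m2] are subprobabilities, hence this copy of the product measure. *)
Section product_sigma_finite.
Context d1 d2 (T1 : measurableType d1) (T2 : measurableType d2) (R : realType).
Variable m1 : {sigma_finite_measure set T1 -> \bar R}.
Variable m2 : {sigma_finite_measure set T2 -> \bar R}.
Local Open Scope ereal_scope.

Definition sf_prod : set (T1 * T2) -> \bar R := m1 \x m2.

HB.instance Definition _ := Measure.on sf_prod.

Let sf_prod_sigma_finite : sigma_finite setT sf_prod.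
Proof.
have /sigma_finiteP[F [TF ndF Foo]] := sigma_finiteT m1.
have /sigma_finiteP[G [TG ndG Goo]] := sigma_finiteT m2.
exists (fun n => F n `*` G n).
  rewrite -setXTT TF TG; apply/seteqP; split=> [[x y]|[x y]].
    move=> [/= [n _ Fnx] [k _ Gky]]; exists (maxn n k) => //; split.
      by move: x Fnx; exact/subsetPset/ndF/leq_maxl.
    by move: y Gky; exact/subsetPset/ndG/leq_maxr.
  by move=> [n _ []/= ? ?]; split; exists n.
move=> k; have [? ?] := Foo k; have [? ?] := Goo k.
split; first exact: measurableX.
by rewrite /sf_prod product_measure1E// lte_mul_pinfty// ge0_fin_numE.
Qed.

HB.instance Definition _ := Measure_isSigmaFinite.Build _ _ _ sf_prod
  sf_prod_sigma_finite.

End product_sigma_finite.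

(* R^n as an iterated product, so that the product measures of the library apply;
   [vec] identifies it with the row vectors. *)
Fixpoint sp_disp (R : realType) (n : nat) : measure_display :=
  match n with
  | 0 => default_measure_display
  | n'.+1 => measure_prod_display (sigma_display (R.-ocitv.-measurable), sp_disp R n')
  end.

Fixpoint sp (R : realType) (n : nat) : measurableType (sp_disp R n) :=
  match n return measurableType (sp_disp R n) with
  | 0 => unit
  | n'.+1 => (measurableTypeR R * sp R n')%type
  end.

Fixpoint mu (R : realType) (n : nat) :
    {sigma_finite_measure set (sp R n) -> \bar R} :=
  match n return {sigma_finite_measure set (sp R n) -> \bar R} with
  | 0 => \d_tt
  | n'.+1 => sf_prod (@lebesgue_measure R) (mu R n')
  end.

Fixpoint vec (R : realType) (n : nat) : sp R n -> 'rV[R]_n :=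
  match n return sp R n -> 'rV[R]_n with
  | 0 => fun=> 0
  | n'.+1 => fun p => row_mx (\row_(j < 1) p.1) (vec p.2)
  end.

Fixpoint unvec (R : realType) (n : nat) : 'rV[R]_n -> sp R n :=
  match n return 'rV[R]_n -> sp R n with
  | 0 => fun=> tt
  | n'.+1 => fun x => (x 0 0, unvec (@rsubmx R 1 1 n' x))
  end.

Section vec_theory.
Variable R : realType.

Lemma row_mx_row0 n (a : R) (x : 'rV[R]_n) i :
  (row_mx (\row_(j < 1) a) x : 'rV_n.+1) i 0 = a.
Proof. by rewrite mxE; case: splitP => [k _|//]; rewrite mxE. Qed.

Lemma row_mx_rowS n (a : R) (x : 'rV[R]_n) i j :
  (row_mx (\row_(j < 1) a) x : 'rV_n.+1) i (rshift 1 j) = x i j.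
Proof. exact: row_mxEr. Qed.

Lemma unvecK n : cancel (@unvec R n) (@vec R n).
Proof.
elim: n => [|n IH] x /=; first by apply/matrixP => i [].
rewrite IH; apply: etrans (@hsubmxK R 1 1 n x); apply: (f_equal2 (@row_mx R 1 1 n)) => //.
apply/rowP => i; rewrite !mxE ord1; congr (x _ _).
by apply/val_inj.
Qed.

Lemma row_mxD n (a b : R) (x y : 'rV[R]_n) :
  row_mx (\row_(j < 1) a) x + row_mx (\row_(j < 1) b) y =
  row_mx (\row_(j < 1) (a + b)) (x + y).
Proof. by rewrite add_row_mx; congr row_mx; apply/rowP => j; rewrite !mxE. Qed.

Lemma row_mxB n (a b : R) (x y : 'rV[R]_n) :
  row_mx (\row_(j < 1) a) x - row_mx (\row_(j < 1) b) y =
  row_mx (\row_(j < 1) (a - b)) (x - y).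
Proof.
by rewrite opp_row_mx add_row_mx; congr row_mx; apply/rowP => j; rewrite !mxE.
Qed.

(** Addition of row vectors transported to the iterated product, where its measurability is checked
    component by component. *)
Fixpoint spD n : sp R n -> sp R n -> sp R n :=
  match n return sp R n -> sp R n -> sp R n with
  | 0 => fun _ _ => tt
  | n'.+1 => fun p q => (p.1 + q.1, spD p.2 q.2)
  end.

Lemma vecD n (z w : sp R n) : vec (spD z w) = vec z + vec w.
Proof.
elim: n z w => [|n IH] z w /=; first by rewrite addr0.
by rewrite IH row_mxD.
Qed.

Lemma measurable_spD n d (T : measurableType d) (f g : T -> sp R n) :
  measurable_fun setT f -> measurable_fun setT g ->
  measurable_fun setT (fun t => spD (f t) (g t)).
Proof.
elim: n f g => [|n IH] f g mf mg /=; first exact: measurable_cst.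
apply: measurable_fun_pair.
  by apply: measurable_funD; apply: measurableT_comp => //.
by apply: IH; apply: measurableT_comp.
Qed.

Lemma mx_ballP n (x y : 'rV[R]_n) e : 0 < e ->
  ball x e y <-> forall j, `|x 0 j - y 0 j| < e.
Proof.
move=> e0; split=> [[_ h] j|h]; first exact: h.
by split=> // i j; rewrite ord1; exact: h.
Qed.

(** The norm of row vectors is the sup norm, so balls are cubes and split as products. *)
Lemma vec_ballS n (x : 'rV[R]_n.+1) e : 0 < e ->
  @vec R n.+1 @^-1` ball x e =
  ball (x 0 0) e `*` (@vec R n @^-1` ball (@rsubmx R 1 1 n x) e).
Proof.
move=> e0; apply/seteqP; split=> [[t z]|[t z]] /=.
  move=> /(mx_ballP _ _ e0) h; split=> /=.
    by have := h 0; rewrite row_mx_row0.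
  by apply/mx_ballP => // j; have := h (rshift 1 j); rewrite row_mx_rowS mxE.
move=> [/= h1 /(mx_ballP _ _ e0) h2]; apply/mx_ballP => // j.
case: (@split_ordP 1 n j) => k ->; last first.
  by rewrite row_mx_rowS; have := h2 k; rewrite mxE.
have -> : lshift n k = 0 :> 'I_n.+1 by apply/val_inj; rewrite /= (ord1 k).
by rewrite row_mx_row0.
Qed.

Lemma measurable_vec_ball n (x : 'rV[R]_n) e : measurable (@vec R n @^-1` ball x e).
Proof.
have [e0|e0] := ltP 0 e; last first.
  rewrite (_ : _ @^-1` _ = set0)//; apply/seteqP; split=> // z /= [].
  by rewrite ltNge e0.
elim: n x => [|n IH] x.
  by [].
by rewrite vec_ballS//; apply: measurableX; [exact: measurable_ball|exact: IH].
Qed.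

Lemma mu_ball n (x : 'rV[R]_n) e : 0 < e ->
  mu R n (@vec R n @^-1` ball x e) = ((e *+ 2) ^+ n)%:E.
Proof.
move=> e0; elim: n x => [|n IH] x /=.
  rewrite diracE mem_set//=; split=> // i; by case.
rewrite vec_ballS//; apply: etrans (product_measure1E _ _ _ _) _.
    exact: measurable_ball.
  exact: measurable_vec_ball.
apply: (etrans (f_equal2 mule (lebesgue_measure_ball _ (ltW e0)) (IH _))).
by rewrite -EFinM exprS.
Qed.

(** [sp R n] carries the product sigma-algebra, which contains cubes; an open set is a countable
    union of cubes with rational centers and radii [1/(m+1)]. *)
Lemma rV_open_measurable n (U : set 'rV[R]_n) : open U ->
  measurable (@vec R n @^-1` U).
Proof.
move=> oU.
pose B (k : 'rV[rat]_n * nat) := ball (map_mx (@ratr R) k.1) k.2.+1%:R^-1.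
pose I := [set k | B k `<=` U].
have -> : @vec R n @^-1` U = \bigcup_(k in I) (@vec R n @^-1` B k).
  apply/seteqP; split=> [z /= Uz|z [k Ik] /= Bz]; last exact: Ik.
  have /nbhs_ballP[e /= e0 eU] : nbhs (vec z) U by exact: open_nbhs_nbhs.
  (* Half of [e], because the cube is centered at a rational point near [vec z] and must stay inside
     the ball of radius [e] around [vec z]. *)
  have [m me] : exists m : nat, m.+1%:R^-1 < e / 2.
    have e20 : 0 < e / 2 by rewrite divr_gt0.
    have [m _ /(_ m (leqnn m)) me] := near_infty_natSinv_lt (PosNum e20).
    by exists m.
  have hq (j : 'I_n) : exists q : rat, `|ratr q - vec z 0 j| < m.+1%:R^-1.
    have lt : vec z 0 j - m.+1%:R^-1 < vec z 0 j + m.+1%:R^-1.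
      by rewrite ltrD2l -subr_gt0 opprK addr_gt0.
    have [q] := rat_in_itvoo lt.
    by rewrite in_itv/= => h; exists q; rewrite distrC ltr_distlC.
  pose q := \row_j xchoose (hq j).
  exists (q, m).
    move=> y /= hy; apply: eU.
    have qz : ball (vec z) (m.+1%:R^-1) (map_mx (@ratr R) q).
      by apply/mx_ballP => // j; rewrite distrC !mxE; exact: xchooseP (hq j).
    apply: (@le_ball _ _ _ (m.+1%:R^-1 + m.+1%:R^-1)).
      by rewrite [leRHS]splitr lerD// ltW.
    exact: ball_triangle qz hy.
  by apply/mx_ballP => //= j; rewrite !mxE; exact: xchooseP (hq j).
rewrite bigcup_mkcond; apply: countable_bigcupT_measurable => [|k].
  exact: countableP.
by case: ifP => // _; exact: measurable_vec_ball.
Qed.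

Lemma rV_closed_measurable n (U : set 'rV[R]_n) : closed U ->
  measurable (@vec R n @^-1` U).
Proof.
move=> cU; rewrite -[U]setCK -preimage_setC; apply: measurableC.
by apply: rV_open_measurable; exact: closed_openC.
Qed.

Lemma rV_continuous_measurable n (g : 'rV[R]_n -> R) : continuous g ->
  measurable_fun setT (g \o @vec R n).
Proof.
move=> cg; apply: (measurability _ (RGenOpens.measurableE R)) => //.
move=> /= _ [_ [a [b ->]] <-]; rewrite setTI comp_preimage.
apply: (@rV_open_measurable n (g @^-1` _)); apply: open_comp => [x _|]; first exact: cg.
exact: interval_open.
Qed.

Lemma rV_open_mu_gt0 n (U : set 'rV[R]_n) : open U -> U !=set0 ->
  (0 < mu R n (@vec R n @^-1` U))%E.
Proof.
move=> oU [x Ux]; have /nbhs_ballP[e /= e0 eU] : nbhs x U by exact: open_nbhs_nbhs.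
apply: (@lt_le_trans _ _ (mu R n (@vec R n @^-1` ball x e))).
  by rewrite mu_ball// lte_fin exprn_gt0// pmulrn_lgt0.
apply: le_measure; rewrite ?inE; first exact: measurable_vec_ball.
  exact: rV_open_measurable.
by move=> z /= /eU.
Qed.

End vec_theory.

(** * Integration of bounded functions with bounded support *)

Section bounded_support.
Variable R : realType.

Lemma normr_row_mx n (t : R) (y : 'rV[R]_n) :
  `|row_mx (\row_(j < 1) t) y : 'rV_n.+1| <= `|t| + `|y|.
Proof.
rewrite [leLHS]mx_normrE; apply: bigmax_le => [|[i j] _ /=].
  by rewrite addr_ge0.
rewrite (ord1 i); case: (@split_ordP 1 n j) => k ->.
  have -> : lshift n k = 0 :> 'I_n.+1 by apply/val_inj; rewrite /= (ord1 k).
  by rewrite row_mx_row0 lerDl.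
rewrite row_mx_rowS; apply: (@le_trans _ _ `|y|); last by rewrite lerDr.
rewrite [leRHS]mx_normrE.
exact: (@le_bigmax _ _ _ 0 (fun k : 'I_1 * 'I_n => `|y k.1 k.2|) (0, k)).
Qed.

Lemma normr_coord n (x : 'rV[R]_n) j : `|x 0 j| <= `|x|.
Proof.
rewrite [leRHS]mx_normrE.
exact: (@le_bigmax _ _ _ 0 (fun k : 'I_1 * 'I_n => `|x k.1 k.2|) (0, j)).
Qed.

Lemma rV_normr_le n (x : 'rV[R]_n) c : 0 <= c ->
  (forall j, `|x 0 j| <= c) -> `|x| <= c.
Proof.
move=> c0 h; rewrite [leLHS]mx_normrE; apply: bigmax_le => // -[i j] _ /=.
by rewrite (ord1 i).
Qed.

Lemma row_mx_normr_ge n (t : R) (y : 'rV[R]_n) :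
  `|y| <= `|row_mx (\row_(j < 1) t) y : 'rV_n.+1|.
Proof.
apply: rV_normr_le => // j.
by rewrite -(row_mx_rowS t); exact: normr_coord.
Qed.

(** The class in which all integrals are taken: it consists of integrable functions and is stable
    under slicing, so Fubini's theorem applies in every dimension. A single [M] bounds both the
    values and the support. *)
Definition bfun n (g : 'rV[R]_n -> R) :=
  measurable_fun setT (g \o @vec R n) /\
  exists M, (forall x, `|g x| <= M) /\ (forall x, M < `|x| -> g x = 0).

Lemma bfun_integrable n (g : 'rV[R]_n -> R) : bfun g ->
  (mu R n).-integrable setT (EFin \o (g \o @vec R n)).
Proof.
move=> [mg [M [gM g0]]].
have M0 : 0 <= M by exact: le_trans (gM 0).
pose B := @vec R n @^-1` ball 0 (M + 1).
have mB : measurable B by exact: measurable_vec_ball.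
have iB : (mu R n).-integrable setT (fun z => (M%:E * (\1_B z)%:E)%E).
  apply: integrableZl => //; apply/integrableP; split.
    exact/measurable_EFinP.
  under eq_integral do rewrite gee0_abs ?lee_fin//.
  by rewrite integral_indic// setIT [ltLHS]mu_ball ?ltry// ltr_pwDr.
apply: le_integrable iB => //; first exact/measurable_EFinP.
move=> z _ /=; rewrite lee_fin indicE.
have [zB|zB] := boolP (z \in B).
  by rewrite mulr1 (le_trans (gM _))// ler_norm.
rewrite mulr0 normr0 g0 ?normr0// ltNge; apply/negP => zM; move/negP: zB; apply.
rewrite inE /B/=; apply/mx_ballP => [|j]; first by rewrite ltr_pwDr.
rewrite mxE sub0r normrN (le_lt_trans (normr_coord _ _))//.
by rewrite (le_lt_trans zM)// ltrDl.
Qed.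

Lemma bfun_slice n (g : 'rV[R]_n.+1 -> R) t : bfun g ->
  bfun (fun y => g (row_mx (\row_(j < 1) t) y)).
Proof.
move=> [mg [M [gM g0]]]; split.
  exact: (@measurable_fun_pair2 _ _ _ (measurableTypeR R) (sp R n) R (g \o @vec R n.+1) t mg).
exists M; split => // y My; apply: g0.
exact: lt_le_trans (row_mx_normr_ge _ _).
Qed.

Definition J n (g : 'rV[R]_n -> R) : R := (\int[mu R n]_z g (vec z))%R.

Lemma EFin_J n (g : 'rV[R]_n -> R) : bfun g ->
  ((J g)%:E = \int[mu R n]_z (g (vec z))%:E)%E.
Proof.
move=> bg; rewrite /J /Rintegral fineK//.
by apply: integrable_fin_num => //; exact: bfun_integrable bg.
Qed.

(** Fubini's theorem and induction on the dimension: every slice is again a [bfun], so the inner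
    integrals are finite for all [t]. *)
Lemma iintE n (g : 'rV[R]_n -> R) : bfun g ->
  iint (fun x => (g x)%:E) = (J g)%:E.
Proof.
elim: n g => [|n IH] g bg.
  by rewrite EFin_J//= integral_dirac//= diracE mem_set// mul1e.
rewrite EFin_J//=.
have -> : (\int[mu R n.+1]_z (g (vec z))%:E)%E =
   (\int[product_measure1 (@lebesgue_measure R) (mu R n)]_z (g (vec (z : sp R n.+1)))%:E)%E by [].
rewrite -integral12_prod_meas1; last exact: bfun_integrable bg.
apply: eq_integral => t _; rewrite IH; last exact: bfun_slice.
by rewrite EFin_J//; exact: bfun_slice.
Qed.

Lemma le_J n (g h : 'rV[R]_n -> R) : bfun g -> bfun h ->
  (forall x, g x <= h x) -> J g <= J h.
Proof.
move=> bg bh gh; apply: le_Rintegral => //; [exact: bfun_integrable bg|].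
exact: bfun_integrable bh.
Qed.

Lemma JZ n (g : 'rV[R]_n -> R) c : bfun g -> J (fun x => c * g x) = c * J g.
Proof. by move=> bg; rewrite /J RintegralZl//; exact: bfun_integrable bg. Qed.

Lemma JB n (g h : 'rV[R]_n -> R) : bfun g -> bfun h ->
  J (fun x => g x - h x) = J g - J h.
Proof.
move=> bg bh; rewrite /J RintegralB//; first exact: bfun_integrable bg.
exact: bfun_integrable bh.
Qed.

Lemma bfunZ n (g : 'rV[R]_n -> R) c : bfun g -> bfun (fun x => c * g x).
Proof.
move=> [mg [M [gM g0]]]; split; first exact: measurable_funM.
exists (`|c| * M + M); have M0 : 0 <= M by exact: le_trans (gM 0).
split=> [x|x h]; last first.
  by rewrite g0 ?mulr0// (le_lt_trans _ h)// lerDr mulr_ge0.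
by rewrite normrM (@le_trans _ _ (`|c| * M)) ?lerDl// ler_wpM2l.
Qed.

Lemma bfunB n (g h : 'rV[R]_n -> R) : bfun g -> bfun h ->
  bfun (fun x => g x - h x).
Proof.
move=> [mg [M [gM g0]]] [mh [N [hN h0]]]; split; first exact: measurable_funB.
have M0 : 0 <= M by exact: le_trans (gM 0).
have N0 : 0 <= N by exact: le_trans (hN 0).
exists (M + N); split=> [x|x hx]; first by rewrite (le_trans (ler_normB _ _))// lerD.
by rewrite g0 ?h0 ?subrr// (le_lt_trans _ hx)// ?lerDl ?lerDr.
Qed.

Lemma J_ge0 n (g : 'rV[R]_n -> R) : (forall x, 0 <= g x) -> 0 <= J g.
Proof. by move=> g0; apply: Rintegral_ge0. Qed.

(** Near a point where [g] is positive, [g] exceeds half of its value there on an open set, and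
    nonempty open sets have positive measure. *)
Lemma J_gt0 n (g : 'rV[R]_n -> R) : bfun g -> continuous g ->
  (forall x, 0 <= g x) -> (exists x, g x != 0) -> 0 < J g.
Proof.
move=> bg cg g0 [x gx].
have gx0 : 0 < g x by rewrite lt_def gx g0.
pose U := g @^-1` [set t | g x / 2 < t].
have oU : open U by apply: open_comp => [? _|]; [exact: cg|exact: open_gt].
have U0 : U !=set0 by exists x; rewrite /U/= ltr_pdivrMr// ltr_pMr// ltr1n.
have mU := rV_open_measurable oU.
rewrite -lte_fin EFin_J//.
apply: (@lt_le_trans _ _ ((g x / 2)%:E * mu R n (@vec R n @^-1` U))%E).
  by rewrite mule_gt0 ?lte_fin ?divr_gt0//; exact: rV_open_mu_gt0.
apply: (@le_trans _ _ (\int[mu R n]_(z in @vec R n @^-1` U) (cst (g x / 2)%:E z))%E).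
  by rewrite integral_cst.
apply: (@le_trans _ _ (\int[mu R n]_(z in @vec R n @^-1` U) (g (vec z))%:E)%E).
  apply: ge0_le_integral => //.
  - by move=> z _; rewrite lee_fin divr_ge0// ltW.
  - by apply/measurable_EFinP; apply: measurable_funTS; exact: bg.1.
  - by move=> z /ltW; rewrite lee_fin.
apply: ge0_subset_integral => //.
  by apply/measurable_EFinP; exact: bg.1.
by move=> z _; rewrite lee_fin.
Qed.

End bounded_support.

(** * Translation invariance *)

Section translation.
Variable R : realType.

Lemma measurable_shift (c : R) :
  measurable_fun setT (fun t : measurableTypeR R => t + c : measurableTypeR R).
Proof.
by apply: continuous_measurable_fun => x; apply: cvgD; [exact: cvg_id|exact: cvg_cst].
Qed.

(** The pushforward under the translation gives half-open intervals their length, and this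
    characterizes Lebesgue measure. *)
Lemma lebesgue_measure_shift (c : R) (A : set (measurableTypeR R)) : measurable A ->
  lebesgue_measure A = lebesgue_measure ((fun t => t + c) @^-1` A).
Proof.
move=> mA.
pose phi : {mfun measurableTypeR R >-> measurableTypeR R} :=
  HB.pack (fun t : measurableTypeR R => t + c : measurableTypeR R)
    (isMeasurableFun.Build _ _ _ _ _ (measurable_shift c)).
apply: (@lebesgue_measure_unique R (pushforward (@lebesgue_measure R) phi)) mA.
move=> X /ocitvP[->|[[a b] /= ab ->]]; first by rewrite !measure0.
rewrite /pushforward/=.
have -> : (fun t => t + c) @^-1` `]a, b] = `]a - c, b - c]%classic.
  by apply/seteqP; split=> t /=; rewrite !in_itv/= ltrBlDr lerBrDr.
rewrite !lebesgue_measure_itv/= !lte_fin ltrD2r ab -!EFinB; congr EFin.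
by rewrite opprB addrA subrK.
Qed.

Lemma ge0_integral_shift (F : R -> \bar R) (c : R) :
  measurable_fun (setT : set (measurableTypeR R)) F -> (forall t, 0 <= F t)%E ->
  (\int[@lebesgue_measure R]_t F ((t + c)%R) = \int[@lebesgue_measure R]_t F t)%E.
Proof.
move=> mF F0.
have := @ge0_integral_pushforward _ _ _ _ R _ (measurable_shift c)
   (@lebesgue_measure R) setT F measurableT mF (fun t _ => F0 t).
rewrite preimage_setT => /esym ->.
apply: eq_measure_integral => [|mc A mA _]; first exact: measurable_shift.
by rewrite [RHS](lebesgue_measure_shift c).
Qed.

Lemma measurable_vec_shift n (G : 'rV[R]_n -> \bar R) (y : 'rV[R]_n) :
  measurable_fun setT (G \o @vec R n) ->
  measurable_fun setT (fun z => G (vec z + y)).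
Proof.
move=> mG.
have -> : (fun z => G (vec z + y)) = (G \o @vec R n) \o (fun z => spD z (unvec y)).
  by apply/funext => z /=; rewrite vecD unvecK.
by apply: measurableT_comp => //; apply: measurable_spD.
Qed.

(** Tonelli's theorem splits the translation into one along the first axis and one along the others,
    covered by the induction hypothesis. *)
Lemma ge0_integral_vec_shift n (G : 'rV[R]_n -> \bar R) (y : 'rV[R]_n) :
  measurable_fun setT (G \o @vec R n) -> (forall x, 0 <= G x)%E ->
  (\int[mu R n]_z G ((vec z + y)%R) = \int[mu R n]_z G (vec z))%E.
Proof.
elim: n G y => [|n IH] G y mG G0.
  by apply: eq_integral => z _ /=; congr G; apply/rowP => -[].
have E F : measurable_fun setT F -> (forall x, 0 <= F x)%E ->
  (\int[mu R n.+1]_z F z = \int[@lebesgue_measure R]_t \int[mu R n]_z F (t, z))%E.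
  by move=> mF F0; rewrite -(@fubini_tonelli1 _ _ _ _ _ (@lebesgue_measure R) (mu R n)).
rewrite E//; last exact: measurable_vec_shift.
rewrite [RHS]E//.
pose H t := (\int[mu R n]_z G (vec ((t, z) : sp R n.+1)))%E.
have mH : measurable_fun setT H.
  pose G' : measurableTypeR R * sp R n -> \bar R := G \o @vec R n.+1.
  by apply: (@measurable_fun_fubini_tonelli_F _ _ _ _ _ (mu R n) G' mG) => z; exact: G0.
transitivity (\int[@lebesgue_measure R]_t H ((t + y 0 0)%R))%E; last first.
  by apply: ge0_integral_shift => // t; exact: integral_ge0.
apply: eq_integral => t _.
have -> : y = row_mx (\row_(j < 1) y 0 0) (@rsubmx R 1 1 n y).
  by rewrite -[LHS](unvecK y)/= unvecK.
rewrite row_mx_row0 /H /=.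
under eq_integral do rewrite row_mxD.
apply: (IH (fun x => G (row_mx (\row_(j < 1) (t + y 0 0)) x))) => //.
exact: (@measurable_fun_pair2 _ _ _ (measurableTypeR R) (sp R n) _ (G \o @vec R n.+1) _ mG).
Qed.

End translation.

(** * Lipschitz functions of one variable *)

Section lipschitz_derivable.
Variable R : realType.
Local Notation leb := (@lebesgue_measure R).

Definition nondecr_lip (c : R) (G : R -> R) :=
  forall x y, x <= y -> 0 <= G y - G x <= c * (y - x).

Section nondecreasing.
Variables (c : R) (G : R -> R).
Hypothesis G_lip : nondecr_lip c G.

Let G_nd : {homo G : x y / x <= y}.
Proof. by move=> x y xy; have /andP[+ _] := G_lip xy; rewrite subr_ge0. Qed.

Let c0 : 0 <= c.
Proof.
have /andP[h1 h2] := @G_lip 0 1 ler01.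
by rewrite subr0 mulr1 in h2; exact: le_trans h1 h2.
Qed.

Let G_cont : continuous G.
Proof.
move=> x; apply/cvgrPdist_lt => e e0; near=> y.
have h : `|G x - G y| <= c * `|x - y|.
  have [xy|/ltW yx] := leP x y.
    have /andP[h1 h2] := G_lip xy.
    by rewrite distrC ger0_norm// distrC ger0_norm// subr_ge0.
  have /andP[h1 h2] := G_lip yx.
  by rewrite ger0_norm// ger0_norm// subr_ge0.
apply: le_lt_trans h _.
apply: (@le_lt_trans _ _ ((c + 1) * `|x - y|)).
  by rewrite ler_wpM2r// lerDl.
rewrite mulrC -ltr_pdivlMr ?ltr_wpDl//.
by near: y; apply: cvgr_dist_lt => //; rewrite divr_gt0// ltr_wpDl.
Unshelve. all: by end_near. Qed.

Let G_rc : right_continuous G.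
Proof. exact: right_continuousW. Qed.

Let Gc : cumulative R R := HB.pack G (isCumulative.Build R _ R G G_nd G_rc).

Lemma lebesgue_stieltjes_itvoc (F : cumulative R R) a b : a <= b ->
  lebesgue_stieltjes_measure F `]a, b]%classic = (F b - F a)%:E.
Proof.
move=> ab; transitivity (wlength F `]a, b]%classic).
  rewrite /lebesgue_stieltjes_measure/= /measure_extension/=.
  by rewrite measurable_mu_extE//; exact: is_ocitv.
by rewrite wlength_itv_bnd.
Qed.

Let nuG := lebesgue_stieltjes_measure Gc.

Let H_nd : {homo (fun x => c * x - G x) : x y / x <= y}.
Proof.
move=> x y xy; have /andP[_ h] := G_lip xy.
by move: h; rewrite mulrBr => h; lra.
Qed.

Let H_cont : continuous (fun x => c * x - G x).
Proof.
move=> x; apply: cvgB; last exact: G_cont.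
by apply: cvgMr; exact: cvg_id.
Qed.

Let Hc : cumulative R R := HB.pack (fun x => c * x - G x)
  (isCumulative.Build R _ R (fun x => c * x - G x) H_nd (right_continuousW H_cont)).

Let S_nd : {homo (fun x => c * x) : x y / x <= y}.
Proof. by move=> x y xy; rewrite ler_wpM2l. Qed.

Let S_cont : continuous (fun x => c * x).
Proof. by move=> x; apply: cvgMr; exact: cvg_id. Qed.

Let Sc : cumulative R R := HB.pack (fun x => c * x)
  (isCumulative.Build R _ R (fun x => c * x) S_nd (right_continuousW S_cont)).

(* The measures with cumulative functions [G] and [c x - G x] add up to [c]
   times Lebesgue measure. *)
Let nuG_dom (A : set (measurableTypeR R)) : measurable A -> leb A = 0%E -> nuG A = 0%E.
Proof.
move=> mA A0.
have e1 : lebesgue_stieltjes_measure Sc A =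
    measure_add (lebesgue_stieltjes_measure Gc) (lebesgue_stieltjes_measure Hc) A.
  apply: lebesgue_stieltjes_measure_unique mA => X /ocitvP[->|[[a b] /= ab ->]].
    by rewrite !measure0.
  rewrite [RHS]measure_addE; apply: etrans (lebesgue_stieltjes_itvoc Sc (ltW ab)) _.
  apply: etrans (esym (f_equal2 adde (lebesgue_stieltjes_itvoc Gc (ltW ab))
    (lebesgue_stieltjes_itvoc Hc (ltW ab)))) => /=.
  by congr EFin; lra.
have e2 : lebesgue_stieltjes_measure Sc A = mscale (NngNum c0) leb A.
  apply: lebesgue_stieltjes_measure_unique mA => X /ocitvP[->|[[a b] /= ab ->]].
    by rewrite !measure0.
  apply: etrans (lebesgue_stieltjes_itvoc Sc (ltW ab)) _.
  by rewrite [RHS]/mscale/= lebesgue_measure_itv/= lte_fin ab -EFinB -EFinM mulrBr.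
move: e1; rewrite e2 measure_addE /mscale/= A0 mule0 => /esym/eqP.
by rewrite padde_eq0// => /andP[/eqP].
Qed.

(** On a bounded interval the Stieltjes measure of [G] is finite and absolutely continuous. Up to a
    constant, [G] is the indefinite integral of its density, hence differentiable almost
    everywhere. *)
Lemma nondecr_lip_ae_derivable : leb.-negligible [set x | ~ derivable G x 1].
Proof.
suff h (n : nat) : leb.-negligible [set x | - n%:R < x < n%:R /\ ~ derivable G x 1].
  apply: negligibleS (negligible_bigcup h) => x /= nd.
  have [n xn] : exists n : nat, `|x| < n%:R.
    by exists (Num.bound `|x|); exact: archi_boundP.
  by exists n => //; split=> //; rewrite -ltr_norml.
(* The Stieltjes measure is cut down to a bounded interval, which makes it finite and its density
   integrable. *)
pose D : set (measurableTypeR R) := `]- n%:R, n%:R]%classic.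
have mD : measurable D by exact: measurable_itv.
have nn : - n%:R <= n%:R :> R by apply: (@le_trans _ _ 0); rewrite ?oppr_le0.
have nuD : (nuG D < +oo)%E by rewrite [nuG _]lebesgue_stieltjes_itvoc// ltry.
pose nu : {finite_measure set (measurableTypeR R) -> \bar R} := mfrestr mD nuD.
have nu_leb : nu `<< leb.
  apply/null_content_dominatesP => A mA A0.
  apply: nuG_dom; first exact: measurableI.
  exact: (subset_measure0 (measurableI _ _ mA mD) mA (@subIsetl _ _ _) A0).
have [g [g0 gfin gint gE]] := radon_nikodym_sigma_finite nu_leb.
pose r := fine \o g.
have rg : EFin \o r = g by apply/funext => t; rewrite /= fineK.
have intr A : measurable A -> leb.-integrable A (EFin \o r).
  by move=> mA; rewrite rg; exact: (integrableS measurableT).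
have rloc : locally_integrable setT r.
  by apply: open_integrable_locally; [exact: openT|exact: intr].
have := FTC1Ny (fun y => intr _ (measurable_itv _)) rloc.
apply: negligibleS => x /= [/andP[nx xn] ndG] [dF _]; apply: ndG.
suff : derivable (fun y => (G y - G (- n%:R))) x 1.
  move=> dG; have -> : G = (fun y => G y - G (- n%:R)) + cst (G (- n%:R)).
    by apply/funext => y; rewrite /= addrfctE subrK.
  exact: derivableD.
apply: near_eq_derivable dF; near=> y.
have ny : - n%:R < y by near: y; exact: lt_nbhsr.
have yn : y < n%:R by near: y; exact: lt_nbhsl.
(* Since [nu] is carried by []-n, n]], its mass up to [y] is [G y - G (- n)]. *)
rewrite /Rintegral [X in fine X](_ : _ = nu `]-oo, y]%classic); last first.
  by rewrite gE; [rewrite -rg|exact: measurable_itv].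
have -> : nu `]-oo, y]%classic = nuG `]- n%:R, y]%classic.
  rewrite /nu/= /mfrestr/= /mrestr; congr nuG.
  apply/seteqP; split => t /=; rewrite /D/= !in_itv/=.
    by move=> [ty /andP[nt _]]; rewrite nt.
  by move=> /andP[nt ty]; rewrite ty nt (le_trans ty)// ltW.
by rewrite [nuG _]lebesgue_stieltjes_itvoc// ltW.
Unshelve. all: by end_near. Qed.

End nondecreasing.

(** Adding [L x] makes [F] nondecreasing and [2 L]-Lipschitz, and does not affect
    differentiability. *)
Lemma lipschitz_ae_derivable (L : R) (F : R -> R) :
  (forall x y, `|F x - F y| <= L * `|x - y|) ->
  leb.-negligible [set x | ~ derivable F x 1].
Proof.
move=> FL.
have Gl : nondecr_lip (L + L) (fun x => F x + L * x).
  move=> x y xy; have := FL y x.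
  rewrite (ger0_norm (_ : 0 <= y - x)) ?subr_ge0// ler_norml => /andP[h1 h2].
  by apply/andP; split; lra.
apply: negligibleS (nondecr_lip_ae_derivable Gl) => x /= ndF dG; apply: ndF.
have -> : F = (fun x => F x + L * x) - (fun x => L * x).
  by apply/funext => y; rewrite /= fctE addrK.
by apply: derivableB => //; apply: derivableM.
Qed.

End lipschitz_derivable.

(** * Rademacher's theorem *)

Section approximate_differential.
Variable R : realType.

Definition dotr n (q h : 'rV[R]_n) : R := \sum_i q 0 i * h 0 i.

Lemma dotrDl n (p q h : 'rV[R]_n) : dotr (p + q) h = dotr p h + dotr q h.
Proof. by rewrite /dotr -big_split; apply: eq_bigr => i _; rewrite mxE mulrDl. Qed.

Lemma dotrDr n (p h k : 'rV[R]_n) : dotr p (h + k) = dotr p h + dotr p k.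
Proof. by rewrite /dotr -big_split; apply: eq_bigr => i _; rewrite mxE mulrDr. Qed.

Lemma dotrZr n (p h : 'rV[R]_n) c : dotr p (c *: h) = c * dotr p h.
Proof. by rewrite /dotr mulr_sumr; apply: eq_bigr => i _; rewrite mxE mulrCA. Qed.

Lemma dotrNl n (p h : 'rV[R]_n) : dotr (- p) h = - dotr p h.
Proof. by rewrite /dotr -sumrN; apply: eq_bigr => i _; rewrite mxE mulNr. Qed.

Lemma dotr_row_mx n (a s : R) (q k : 'rV[R]_n) :
  dotr (row_mx (\row_(j < 1) a) q : 'rV_n.+1) (row_mx (\row_(j < 1) s) k) =
  a * s + dotr q k.
Proof.
rewrite /dotr big_ord_recl !row_mx_row0; congr (_ + _).
apply: eq_bigr => i _; have -> : lift ord0 i = rshift 1 i by apply/val_inj.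
by rewrite !row_mx_rowS.
Qed.

Lemma le_dotr n (q h : 'rV[R]_n) c : (forall i, `|q 0 i| <= c) ->
  `|dotr q h| <= n%:R * c * `|h|.
Proof.
move=> qc; apply: le_trans (ler_norm_sum _ _ _) _.
apply: (@le_trans _ _ (\sum_(i < n) c * `|h|)).
  by apply: ler_sum => i _; rewrite normrM ler_pM// normr_coord.
by rewrite sumr_const card_ord -[leLHS]mulr_natl mulrA.
Qed.

(* [u] is approximable at [x], to first order and along the increments of [H],
   by linear maps. For [H = setT] this is differentiability, but in a form whose
   measurability in [x] is clear. *)
Definition lin_approx n (u : 'rV[R]_n -> R) (H : set 'rV[R]_n) (eps : R)
  (q : 'rV[R]_n) (d : R) : set 'rV[R]_n :=
  [set x | forall h, H h -> `|h| < d -> `|u (x + h) - u x - dotr q h| <= eps * `|h|].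

Definition approx_diff n (u : 'rV[R]_n -> R) (H : set 'rV[R]_n) : set 'rV[R]_n :=
  [set x | forall eps, 0 < eps -> exists q d, 0 < d /\ lin_approx u H eps q d x].

Definition rat_approx n (u : 'rV[R]_n -> R) (H : set 'rV[R]_n) (k : nat)
  (i : 'rV[rat]_n * nat) : set 'rV[R]_n :=
  lin_approx u H k.+1%:R^-1 (map_mx ratr i.1) i.2.+1%:R^-1.

Lemma natSinv_lt (e : R) : 0 < e -> exists m : nat, m.+1%:R^-1 < e.
Proof.
move=> e0; have [m _ /(_ m (leqnn m)) me] := near_infty_natSinv_lt (PosNum e0).
by exists m.
Qed.

(** Slopes may be taken rational and radii of the form [1/(m+1)] at the expense of half the
    tolerance. This leaves countably many sets [rat_approx], as is needed for measurability and for
    the covering by sets of uniform approximation. *)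
Lemma approx_diffE n (u : 'rV[R]_n -> R) H :
  approx_diff u H = \bigcap_k \bigcup_i rat_approx u H k i.
Proof.
apply/seteqP; split=> x hx.
  move=> k _; pose e : R := k.+1%:R^-1.
  have e0 : 0 < e by rewrite invr_gt0.
  have [|q [d [d0 qd]]] := hx (e / 2); first by rewrite divr_gt0.
  have [m md] := natSinv_lt d0.
  (* Changing the slope by [c] in each coordinate changes the linear map by at most [n c] times
     [|h|]; dividing by [n + 1] also covers [n = 0]. *)
  pose c := e / 2 / n.+1%:R.
  have c0 : 0 < c by rewrite !divr_gt0.
  have hq (j : 'I_n) : exists r : rat, `|ratr r - q 0 j| < c.
    have lt : q 0 j - c < q 0 j + c by rewrite ltrD2l -subr_gt0 opprK addr_gt0.
    have [r] := rat_in_itvoo lt.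
    by rewrite in_itv/= => h; exists r; rewrite distrC ltr_distlC.
  exists (\row_j xchoose (hq j), m) => //= h Hh hm.
  set p := map_mx _ _.
  have -> : u (x + h) - u x - dotr p h =
     (u (x + h) - u x - dotr q h) + dotr (q - p) h.
    by rewrite dotrDl dotrNl; ring.
  apply: le_trans (ler_normD _ _) _.
  have -> : k.+1%:R^-1 * `|h| = e / 2 * `|h| + e / 2 * `|h|.
    by rewrite -mulrDl -splitr.
  apply: lerD; first by apply: qd => //; exact: lt_trans hm md.
  have qp : forall i, `|(q - p) 0 i| <= c.
    by move=> i; rewrite !mxE distrC ltW//; exact: xchooseP (hq i).
  apply: le_trans (le_dotr h qp) _.
  rewrite ler_wpM2r// /c mulrCA -[leRHS]mulr1 ler_wpM2l ?divr_ge0// ?(ltW e0)//.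
  by rewrite ler_pdivrMr// mul1r ler_nat.
move=> e e0; have [k ke] := natSinv_lt e0.
have [[q m] _ h] := hx k I.
exists (map_mx ratr q), m.+1%:R^-1; split; first by rewrite invr_gt0.
by move=> l Hl lm; rewrite (le_trans (h _ Hl lm))// ler_wpM2r// ltW.
Qed.

(** Lipschitz for the sup norm, the norm underlying balls and differentials, whereas [lipschitz_fun]
    uses the Euclidean norm. *)
Definition lipr n (u : 'rV[R]_n -> R) (L : R) :=
  forall x y, `|u x - u y| <= L * `|x - y|.

Lemma lipr_continuous n (u : 'rV[R]_n -> R) L : lipr u L -> continuous u.
Proof.
move=> uL x; apply/(@cvgrPdist_lt _ R^o _ (nbhs x)) => e e0; apply/nbhs_ballP.
have L0 : 0 < `|L| + 1 by rewrite ltr_wpDl.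
exists (e / (`|L| + 1)); first by rewrite /= divr_gt0.
move=> y; rewrite -ball_normE/= => xy; apply: le_lt_trans (uL x y) _.
apply: (@le_lt_trans _ _ ((`|L| + 1) * `|x - y|)).
  by rewrite ler_wpM2r// (le_trans (ler_norm _))// lerDl.
by rewrite mulrC -ltr_pdivlMr.
Qed.

(* Stated over abstract spaces, since unification unfolds the neighborhood
   filters of matrices when the convergence lemmas are applied to them. *)
Lemma continuous_subf (T : topologicalType) (f g : T -> R) :
  continuous f -> continuous g -> continuous (fun x => f x - g x).
Proof. by move=> cf cg x; apply: cvgB; [exact: cf|exact: cg]. Qed.

Lemma continuous_normf (T : topologicalType) (f : T -> R) :
  continuous f -> continuous (fun x => `|f x|).
Proof. by move=> cf x; apply: cvg_norm; exact: cf. Qed.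

Lemma continuous_shiftf (V : normedModType R) (f : V -> R) (h : V) :
  continuous f -> continuous (fun x => f (x + h)).
Proof.
move=> cf x; apply: (@continuous_comp _ _ _ (fun x => x + h) f); last exact: cf.
by apply: cvgD; [exact: cvg_id|exact: cvg_cst].
Qed.

(** For each fixed [h] the estimate is a closed condition on [x], and an intersection of closed sets
    is closed even if [H] is uncountable. *)
Lemma closed_lin_approx n (u : 'rV[R]_n -> R) H eps q d : continuous u ->
  closed (lin_approx u H eps q d).
Proof.
move=> cu.
have cF (h : 'rV[R]_n) : continuous (fun x : 'rV[R]_n => `|u (x + h) - u x - dotr q h|).
  apply: continuous_normf; apply: continuous_subf; last exact: cst_continuous.
  by apply: continuous_subf => //; exact: continuous_shiftf.
have -> : lin_approx u H eps q d = \bigcap_(h in [set h | H h /\ `|h| < d])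
    ((fun x => `|u (x + h) - u x - dotr q h|) @^-1` [set t | t <= eps * `|h|]).
  by apply/seteqP; split=> x /= hx h => [[]|Hh hd]; apply: hx.
apply: closed_bigI => h _.
apply: preimage_closed; last exact: closed_le.
by move=> x _; exact: cF.
Qed.

Lemma measurable_approx_diff n (u : 'rV[R]_n -> R) H : continuous u ->
  measurable (@vec R n @^-1` approx_diff u H).
Proof.
move=> cu; rewrite approx_diffE preimage_bigcap; apply: bigcapT_measurable => k.
rewrite preimage_bigcup; apply: countable_bigcupT_measurable => [|i].
  exact: countableP.
by apply: rV_closed_measurable; exact: closed_lin_approx.
Qed.

Lemma derivable_approx (f : R -> R) x : derivable f x 1 ->
  exists l, forall e, 0 < e -> exists d, 0 < d /\
    forall s, `|s| < d -> `|f (x + s) - f x - l * s| <= e * `|s|.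
Proof.
move=> /cvg_ex[l /= fl]; exists l => e e0.
move/cvgrPdist_le : fl => /(_ _ e0)/nbhs_ballP[d /= d0 h].
exists d; split=> // s sd.
have [->|s0] := eqVneq s 0; first by rewrite addr0 mulr0 !subrr normr0 mulr0.
have := h s; rewrite /ball/= sub0r normrN => /(_ sd s0).
rewrite [s *: 1]mulr1 [X in `|l - X|](_ : _ = s^-1 * (f (x + s) - f x)); last first.
  by rewrite (addrC x).
move=> le; rewrite -ler_pdivrMr ?normr_gt0// -normf_div distrC in le *.
by apply: le_trans le; rewrite le_eqVlt; apply/orP; left; apply/eqP; congr `|_|; field.
Qed.

Definition dist (A : set R) (t : R) := inf [set `|t - a| | a in A].

Lemma dist_lip (A : set R) x y : A !=set0 -> `|dist A x - dist A y| <= 1 * `|x - y|.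
Proof.
move=> A0; rewrite mul1r.
suff h s t : dist A s <= dist A t + `|s - t|.
  rewrite ler_norml; apply/andP; split.
    by have := h y x; rewrite distrC; lra.
  by have := h x y; lra.
rewrite -lerBlDr; apply: lb_le_inf.
  by have [a Aa] := A0; exists `|t - a|, a.
move=> _ [a Aa <-]; rewrite lerBlDr.
apply: (@le_trans _ _ `|s - a|).
  apply: ge_inf; last by exists a.
  by exists 0 => _ [b _ <-].
have -> : s - a = (t - a) + (s - t) by ring.
exact: ler_normD.
Qed.

(* The distance to [A] vanishes on [A], so where it is differentiable at a point
   of [A], its derivative there is 0. *)
Lemma dist_derivable_dense (A : set R) t : A t -> derivable (dist A) t 1 ->
  forall eta, 0 < eta -> exists d, 0 < d /\
    forall s, `|s| < d -> exists s', A (t + s') /\ `|s - s'| <= eta * `|s|.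
Proof.
move=> At /derivable_approx[l hl] eta eta0.
have dist_ge0 s : 0 <= dist A s.
  by apply: lb_le_inf; [exists `|s - t|, t|move=> _ [a _ <-]].
have dt0 : dist A t = 0.
  apply/eqP; rewrite eq_le dist_ge0 andbT; apply: ge_inf.
    by exists 0 => _ [b _ <-].
  by exists t => //; rewrite subrr normr0.
have [|d [d0 hd]] := hl (eta / 4); first by rewrite divr_gt0.
exists d; split=> // s sd.
have [->|s0] := eqVneq s 0.
  by exists 0; rewrite addr0 subrr normr0 mulr0.
(* The estimates at [s] and [- s], together with [0 <= dist A (t - s)], eliminate the slope [l]. *)
have ds : dist A (t + s) <= eta / 2 * `|s|.
  have := hd s sd; have := hd (- s); rewrite normrN => /(_ sd).
  rewrite dt0 !subr0 mulrN opprK !ler_norml => /andP[_ h1] /andP[_ h2].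
  have := dist_ge0 (t - s); lra.
(* The infimum need not be attained; the other half of [eta] pays for a point of [A] close to it. *)
have [_ [a Aa <-] ha] : exists2 r, [set `|t + s - a| | a in A] r & r < eta * `|s|.
  have e0 : 0 < eta / 2 * `|s| by rewrite mulr_gt0 ?normr_gt0// divr_gt0.
  have [|r Ar hr] := inf_adherent e0 (_ : has_inf [set `|t + s - a| | a in A]).
    split; first by exists `|t + s - t|, t.
    by exists 0 => _ [b _ <-].
  exists r => //; apply: lt_le_trans hr _; rewrite -/(dist A (t + s)).
  by lra.
exists (a - t); rewrite addrC subrK; split=> //.
by rewrite opprB addrCA addrA ltW.
Qed.

End approximate_differential.

(** * Gluing differentiability along the first axis and along the slices *)

Section rademacher.
Variable R : realType.

Local Notation rmx t y := (row_mx (\row_(j < 1) t) y : 'rV_(_.+1)).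

Lemma rmx_split n (h : 'rV[R]_n.+1) : h = rmx (h 0 0) (@rsubmx R 1 1 n h).
Proof. by rewrite -[LHS](unvecK h)/= unvecK. Qed.

Lemma normr_rmx0 n (t : R) : `|rmx t (0 : 'rV[R]_n)| <= `|t|.
Proof. by apply: le_trans (normr_row_mx _ _) _; rewrite normr0 addr0. Qed.

Lemma normr_0rmx n (y : 'rV[R]_n) : `|rmx 0 y| <= `|y|.
Proof. by apply: le_trans (normr_row_mx _ _) _; rewrite normr0 add0r. Qed.

(* The increment along [y] is computed at a nearby point [t + s'] of the set on
   which the linear approximation of the slices is uniform; moving there costs
   [o(s)] by the Lipschitz property. *)
Lemma approx_diff_glue n (u : 'rV[R]_n.+1 -> R) (L t : R) (y : 'rV[R]_n) :
  lipr u L ->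
  approx_diff u [set rmx s 0 | s in setT] (rmx t y) ->
  (forall k, exists i, rat_approx u [set rmx 0 z | z in setT] k i (rmx t y) /\
    forall eta, 0 < eta -> exists d, 0 < d /\ forall s, `|s| < d ->
      exists s', rat_approx u [set rmx 0 z | z in setT] k i (rmx (t + s') y) /\
        `|s - s'| <= eta * `|s|) ->
  approx_diff u setT (rmx t y).
Proof.
move=> uL hX hY e e0.
(* The error budget is [e / 3] for the increment along the first axis, [e / 3] for the one in the
   slice at [t + s'], and [e / 6] for each of two moves between [t + s] and [t + s']. *)
have [k ke] := natSinv_lt (divr_gt0 e0 (ltr0n R 3) : 0 < e / 3).
have [[qy m] [hy hs]] := hY k.
have [|q [d1 [d10 hq]]] := hX (e / 3); first by rewrite divr_gt0.
have L0 : 0 < 6 * (`|L| + 1) by rewrite mulr_gt0// ltr_wpDl.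
have [|d2 [d20 hd]] := hs (e / (6 * (`|L| + 1))); first by rewrite divr_gt0.
(* The first component of the rational slope is dropped: it is only tested on increments
   [rmx 0 z]. *)
pose qr : 'rV[R]_n := rsubmx (map_mx ratr qy : 'rV_(1 + n)).
exists (rmx (q 0 0) qr), (Num.min (Num.min d1 d2) m.+1%:R^-1); split.
  by rewrite !lt_min d10 d20 invr_gt0/=.
move=> h _; rewrite !lt_min => /andP[/andP[hd1 hd2] hm].
pose s := h 0 0; pose z : 'rV[R]_n := @rsubmx R 1 1 n h.
have hE : h = rmx s z by exact: rmx_split.
rewrite {1 2}hE.
have sh : `|s| <= `|h| by exact: normr_coord.
have zh : `|z| <= `|h| by rewrite [in leRHS]hE; exact: row_mx_normr_ge.
have [s' [As' ss']] := hd s (le_lt_trans sh hd2).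
rewrite dotr_row_mx row_mxD.
have e1 : `|u (rmx (t + s) y) - u (rmx t y) - q 0 0 * s| <= e / 3 * `|h|.
  have := hq (rmx s 0); rewrite row_mxD addr0 (rmx_split q) dotr_row_mx row_mx_row0.
  have -> : dotr (@rsubmx R 1 1 n q) 0 = 0.
    by rewrite /dotr big1// => i _; rewrite !mxE mulr0.
  rewrite addr0 => H; apply: le_trans (H _ _) _.
  - by exists s.
  - by apply: le_lt_trans hd1; apply: le_trans sh; exact: normr_rmx0.
  - by rewrite ler_wpM2l ?divr_ge0 ?(ltW e0)//; apply: le_trans sh; exact: normr_rmx0.
have e2 : `|u (rmx (t + s') (y + z)) - u (rmx (t + s') y) - dotr qr z| <= e / 3 * `|h|.
  have := As' (rmx 0 z); rewrite row_mxD addr0 [map_mx _ _]rmx_split dotr_row_mx.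
  rewrite mulr0 add0r => H; apply: le_trans (H _ _) _.
  - by exists z.
  - by apply: le_lt_trans hm; apply: le_trans zh; exact: normr_0rmx.
  - by apply: ler_pM => //; [exact: ltW|apply: le_trans zh; exact: normr_0rmx].
have e3 w : `|u (rmx (t + s) w) - u (rmx (t + s') w)| <= e / 6 * `|h|.
  apply: le_trans (uL _ _) _; rewrite row_mxB subrr.
  apply: (@le_trans _ _ ((`|L| + 1) * (e / (6 * (`|L| + 1)) * `|h|))); last first.
    by rewrite mulrA le_eqVlt; apply/orP; left; apply/eqP; field; rewrite gt_eqF// ltr_wpDl.
  apply: (@le_trans _ _ ((`|L| + 1) * `|rmx (t + s - (t + s')) (0 : 'rV[R]_n)|)).
    by rewrite ler_wpM2r// (le_trans (ler_norm _))// lerDl.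
  rewrite ler_wpM2l// ?addr_ge0//; apply: le_trans (normr_rmx0 _ _) _.
  have -> : t + s - (t + s') = s - s' by ring.
  by apply: le_trans ss' _; rewrite ler_wpM2l// ltW// divr_gt0.
have -> : u (rmx (t + s) (y + z)) - u (rmx t y) - (q 0 0 * s + dotr qr z) =
   (u (rmx (t + s) y) - u (rmx t y) - q 0 0 * s) +
   (u (rmx (t + s') (y + z)) - u (rmx (t + s') y) - dotr qr z) +
   (u (rmx (t + s) (y + z)) - u (rmx (t + s') (y + z))) -
   (u (rmx (t + s) y) - u (rmx (t + s') y)) by ring.
have := e3 y; have := e3 (y + z); move: e1 e2.
rewrite !ler_norml => /andP[? ?] /andP[? ?] /andP[? ?] /andP[? ?].
have := normr_ge0 h => ?.
by apply/andP; split; lra.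
Qed.

Lemma negligible_bigcup_count d (T : measurableType d) (I : countType)
    (m : {measure set T -> \bar R}) (F : I -> set T) :
  (forall i, m.-negligible (F i)) -> m.-negligible (\bigcup_i F i).
Proof.
move=> nF.
pose G k := if unpickle k is Some i then F i else set0.
have nG k : m.-negligible (G k).
  by rewrite /G; case: unpickle => // ; exact: negligible_set0.
apply: negligibleS (negligible_bigcup nG) => x [i _ Fi].
by exists (pickle i) => //; rewrite /G pickleK.
Qed.

(* Only countably many sets [rat_approx u _ k i] are involved; the points of such
   a set where the distance to it is not differentiable are negligible. *)
Lemma ae_uniform_slice n (u : 'rV[R]_n.+1 -> R) (y : 'rV[R]_n) :
  (@lebesgue_measure R).-negligible [set t : R |
    approx_diff u [set rmx 0 z | z in setT] (rmx t y) /\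
    ~ (forall k, exists i, rat_approx u [set rmx 0 z | z in setT] k i (rmx t y) /\
    forall eta, 0 < eta -> exists d, 0 < d /\ forall s, `|s| < d ->
      exists s', rat_approx u [set rmx 0 z | z in setT] k i (rmx (t + s') y) /\
        `|s - s'| <= eta * `|s|)].
Proof.
pose A (p : nat * ('rV[rat]_n.+1 * nat)) := [set t |
  rat_approx u [set rmx 0 z | z in setT] p.1 p.2 (rmx t y)].
pose F p := [set t | A p t /\ ~ derivable (dist (A p)) t 1].
have nF p : (@lebesgue_measure R).-negligible (F p).
  have [A0|A0] := pselect (A p !=set0); last first.
    apply: negligibleS (negligible_set0 _) => t [At _].
    by apply: A0; exists t.
  apply: negligibleS (lipschitz_ae_derivable (fun x y => dist_lip x y A0)).
  by move=> t [].
apply: negligibleS (negligible_bigcup_count nF) => t [].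
rewrite approx_diffE => ht; apply: contra_notP => nt k.
have [i _ hi] := ht k I.
exists i; split=> //; apply: (@dist_derivable_dense _ (A (k, i))) => //.
by apply: contra_notP nt => nd; exists (k, i).
Qed.

End rademacher.

(** * Null sets of a product measure *)

Section product_null.
Context d1 d2 (T1 : measurableType d1) (T2 : measurableType d2) (R : realType).
Variable m1 : {sigma_finite_measure set T1 -> \bar R}.
Variable m2 : {sigma_finite_measure set T2 -> \bar R}.
Implicit Types B : set (T1 * T2).
Local Open Scope ereal_scope.

(** The product measure integrates the sections at a fixed first coordinate; Tonelli's theorem for
    indicators exchanges the two roles. *)
Lemma sf_prod_ysectionE B : measurable B ->
  sf_prod m1 m2 B = \int[m2]_y m1 (ysection B y).
Proof.
move=> mB; transitivity (\int[m1]_x (m2 \o xsection B) x) => //.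
by rewrite -(indic_fubini_tonelli_FE m2 mB) (indic_fubini_tonelli m1 m2 mB)
  (indic_fubini_tonelli_GE m1 mB).
Qed.

Lemma sf_prod_eq0P B : measurable B ->
  sf_prod m1 m2 B = 0 <-> {ae m2, forall y, m1 (ysection B y) = 0}.
Proof.
move=> mB; rewrite sf_prod_ysectionE//.
have mf : measurable_fun setT (fun y => m1 (ysection B y)).
  exact: measurable_fun_ysection.
have := ae_eq_integral_abs m2 measurableT mf.
under eq_integral do rewrite gee0_abs//.
move=> ->; split; first by apply: filterS => y /(_ I).
by apply: filterS => y h _.
Qed.

End product_null.

Section rademacher.
Variable R : realType.

Local Notation rmx t y := (row_mx (\row_(j < 1) t) y : 'rV_(_.+1)).

Lemma lipr_slice n (u : 'rV[R]_n.+1 -> R) L t : lipr u L ->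
  lipr (fun y => u (rmx t y)) `|L|.
Proof.
move=> uL x y; apply: le_trans (uL _ _) _; rewrite row_mxB subrr.
apply: (@le_trans _ _ (`|L| * `|rmx 0 (x - y)|)).
  by rewrite ler_wpM2r// ler_norm.
by rewrite ler_wpM2l// normr_0rmx.
Qed.

Lemma lipr_line n (u : 'rV[R]_n.+1 -> R) L y : lipr u L ->
  forall s t, `|u (rmx s y) - u (rmx t y)| <= `|L| * `|s - t|.
Proof.
move=> uL s t; apply: le_trans (uL _ _) _; rewrite row_mxB subrr.
apply: (@le_trans _ _ (`|L| * `|rmx (s - t) (0 : 'rV[R]_n)|)).
  by rewrite ler_wpM2r// ler_norm.
by rewrite ler_wpM2l// normr_rmx0.
Qed.

Lemma approx_diff_slice n (u : 'rV[R]_n.+1 -> R) t y :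
  approx_diff (fun y => u (rmx t y)) setT y ->
  approx_diff u [set rmx 0 z | z in setT] (rmx t y).
Proof.
move=> h e e0; have [q [d [d0 hq]]] := h e e0.
exists (rmx 0 q), d; split => // _ [z _ <-] hd.
rewrite row_mxD addr0 dotr_row_mx mulr0 add0r.
have zz : `|z| <= `|rmx 0 z| by exact: row_mx_normr_ge.
apply: le_trans (hq z I (le_lt_trans zz hd)) _.
by rewrite ler_wpM2l// ltW.
Qed.

Lemma approx_diff_line n (u : 'rV[R]_n.+1 -> R) t y :
  derivable (fun s => u (rmx s y)) t 1 ->
  approx_diff u [set rmx s 0 | s in setT] (rmx t y).
Proof.
move=> /derivable_approx[l hl] e e0; have [d [d0 hd]] := hl e e0.
exists (rmx l 0), d; split => // _ [s _ <-] sd.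
rewrite row_mxD addr0 dotr_row_mx.
have -> : dotr (0 : 'rV[R]_n) 0 = 0 by rewrite /dotr big1// => i _; rewrite mxE mul0r.
have ss : `|s| <= `|rmx s (0 : 'rV[R]_n)|.
  by rewrite -[X in `|X| <= _](row_mx_row0 s (0 : 'rV[R]_n) 0); exact: normr_coord.
rewrite addr0; apply: le_trans (hd s (le_lt_trans ss sd)) _.
by rewrite ler_wpM2l// ltW.
Qed.

Theorem rademacher n (u : 'rV[R]_n -> R) L : lipr u L ->
  mu R n (@vec R n @^-1` (~` approx_diff u setT)) = 0%E.
Proof.
elim: n u L => [|n IH] u L uL.
  rewrite (_ : _ @^-1` _ = set0) ?measure0//.
  apply/seteqP; split=> // z /=; apply => e e0; exists 0, 1; split=> // h _ _.
  have -> : h = 0 by apply/rowP => -[].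
  by rewrite addr0 /dotr big_ord0 subrr subr0 !normr0 mulr0.
have cu := lipr_continuous uL.
pose leb := @lebesgue_measure R.
pose HY := [set rmx 0 z | z in [set: 'rV[R]_n]].
pose HX := [set rmx s (0 : 'rV[R]_n) | s in [set: R]].
pose bad H : set (measurableTypeR R * sp R n) := @vec R n.+1 @^-1` (~` approx_diff u H).
have mbad H : measurable (bad H).
  rewrite /bad -preimage_setC; apply: measurableC.
  exact: (measurable_approx_diff _ cu).
apply/(sf_prod_eq0P leb (mu R n) (mbad setT)).
(* At fixed [t] the section is null by the induction hypothesis for the slice of [u]. The exchange
   of sections turns this into a statement at fixed [z], where the argument in the variable [t]
   takes place. *)
have hY : {ae mu R n, forall z, leb (ysection (bad HY) z) = 0%E}.
  apply/(sf_prod_eq0P leb (mu R n) (mbad HY)).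
  apply: integral0_eq => t _ /=.
  apply: (subset_measure0 _ _ _ (IH _ _ (lipr_slice t uL))).
  - exact: measurable_xsection.
  - rewrite -preimage_setC; apply: measurableC; apply: measurable_approx_diff.
    exact: lipr_continuous (lipr_slice t uL).
  - move=> z /xsectionP/=; apply: contra_not; exact: approx_diff_slice.
apply: filterS hY => z hz.
apply/negligibleP; first exact: measurable_ysection.
have n1 : leb.-negligible (ysection (bad HY) z).
  by apply/negligibleP => //; exact: measurable_ysection.
have n2 := lipschitz_ae_derivable (lipr_line (vec z) uL).
have n3 := ae_uniform_slice u (vec z).
(* The three discarded sets of [t]: the slice is not differentiable at [vec z], the line through
   [vec z] is not, or no set of uniform approximation is dense enough at [t]. *)
apply: negligibleS (negligibleU n1 (negligibleU n2 n3)) => t /ysectionP/= bt.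
apply: contrapT => nt; apply: bt.
have nY : approx_diff u HY (rmx t (vec z)).
  by apply: contrapT => h; apply: nt; left; apply/ysectionP.
apply: (approx_diff_glue uL).
  by apply: approx_diff_line; apply: contrapT => h; apply: nt; right; left.
by apply: contrapT => h; apply: nt; right; right.
Qed.

End rademacher.

(** * Gradients *)

Section differentiability.
Variable R : realType.

Section dotr_linear.
Variables (n : nat) (q : 'rV[R]_n).

Let dotr_is_linear : linear (dotr q : 'rV[R]_n -> R).
Proof. by move=> c h k; rewrite dotrDr dotrZr. Qed.

HB.instance Definition _ :=
  GRing.isLinear.Build R 'rV[R]_n R _ (dotr q) dotr_is_linear.

Lemma dotr_lipr : lipr (dotr q) (n%:R * `|q|).
Proof.
move=> x y; have -> : dotr q x - dotr q y = dotr q (x - y).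
  by rewrite (linearB (dotr q : {linear 'rV[R]_n -> R})).
by apply: le_dotr => i; exact: normr_coord.
Qed.

End dotr_linear.

(** Differentiability with an explicit gradient, in epsilon-delta form, so that estimates avoid the
    little-o notation. *)
Definition has_grad n (u : 'rV[R]_n -> R) (x q : 'rV[R]_n) :=
  forall e, 0 < e -> exists d, 0 < d /\
    forall h, `|h| < d -> `|u (x + h) - u x - dotr q h| <= e * `|h|.

Lemma has_grad_diff n (u : 'rV[R]_n -> R) x q : has_grad u x q ->
  differentiable u x /\ forall h, 'd u x h = dotr q h.
Proof.
move=> hq.
have E e : 0 < e -> \forall h \near (0 : 'rV[R]_n),
    `|u (h + x) - (u x + dotr q h)| <= e * `|h|.
  move=> e0; have [d [d0 hd]] := hq e e0.
  apply/nbhs_ballP; exists d => //= h; rewrite -ball_normE/= sub0r normrN => hd'.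
  by have := hd h hd'; rewrite (addrC h x) opprD addrA.
have c1 : continuous (dotr q : {linear 'rV[R]_n -> R}).
  exact: lipr_continuous (@dotr_lipr n q).
have e2 : 'd u x = dotr q :> ('rV[R]_n -> R).
  apply: (diff_unique c1); apply: eqaddoE; apply/eqaddoP => e e0; exact: E.
split; last by move=> h; rewrite e2.
apply/diff_locallyP; rewrite e2; split; first exact: c1.
by apply: eqaddoE; apply/eqaddoP => e e0; exact: E.
Qed.

Lemma diff_partial n (u : 'rV[R]_n -> R) x h :
  'd u x h = dotr (\row_i partial u i x) h.
Proof.
rewrite {1}[h]row_sum_delta linear_sum /dotr; apply: eq_bigr => i _.
by rewrite linearZ/= mxE mulrC.
Qed.

Lemma diff_has_grad n (u : 'rV[R]_n -> R) x : differentiable u x ->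
  has_grad u x (\row_i partial u i x).
Proof.
move=> /diff_locally/eqaddoP h e e0; have /nbhs_ballP[d /= d0 hd] := h e e0.
exists d; split=> // k kd.
have := hd k; rewrite -ball_normE/= sub0r normrN => /(_ kd).
rewrite !fctE/= -diff_partial.
by rewrite (addrC k x) opprD addrA.
Qed.

Lemma has_grad_partial n (u : 'rV[R]_n -> R) x q : has_grad u x q ->
  \row_i partial u i x = q.
Proof.
move=> /has_grad_diff[_ hq]; apply/rowP => i; rewrite mxE /partial hq /dotr.
rewrite (bigD1 i)//= big1 => [|j ji]; first by rewrite mxE !eqxx mulr1 addr0.
by rewrite mxE (negbTE ji) andbF mulr0.
Qed.

Lemma gradnormE n (u : 'rV[R]_n -> R) x q : has_grad u x q -> gradnorm u x = enorm q.
Proof.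
move=> hq; rewrite /gradnorm; case: asboolP => [_|]; first by rewrite (has_grad_partial hq).
by move=> []; exact: (has_grad_diff hq).1.
Qed.

Lemma gradnorm_ndiff n (u : 'rV[R]_n -> R) x : ~ differentiable u x -> gradnorm u x = 0.
Proof. by move=> nd; rewrite /gradnorm; case: asboolP. Qed.

Lemma has_grad_approx n (u : 'rV[R]_n -> R) x q : has_grad u x q ->
  approx_diff u setT x.
Proof.
move=> hq e e0; have [d [d0 hd]] := hq e e0.
by exists q, d; split=> // h _; exact: hd.
Qed.

(** The slopes for the tolerances [1/(k+1)] form a Cauchy sequence, since any two of them can be
    compared on a common small increment along each axis; the gradient is their limit. *)
Lemma approx_has_grad n (u : 'rV[R]_n -> R) x : approx_diff u setT x ->
  exists q, has_grad u x q.
Proof.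
move=> hx.
have hk (k : nat) : exists q, exists d, 0 < d /\ lin_approx u setT k.+1%:R^-1 q d x.
  by apply: hx; rewrite invr_gt0.
have [q hq] := choice hk.
have qq k l i : q k 0 i - k.+1%:R^-1 <= q l 0 i + l.+1%:R^-1.
  have [d1 [d10 h1]] := hq k; have [d2 [d20 h2]] := hq l.
  pose c := Num.min d1 d2 / 2.
  have m0 : 0 < Num.min d1 d2 by rewrite lt_min d10 d20.
  have c0 : 0 < c by rewrite divr_gt0.
  have cm : c < Num.min d1 d2 by rewrite ltr_pdivrMr// ltr_pMr// ltr1n.
  pose h : 'rV[R]_n := c *: delta_mx 0 i.
  have hc : `|h| <= c.
    apply: rV_normr_le => [|j]; first exact: ltW.
    rewrite !mxE eqxx/=; case: eqP => _; first by rewrite mulr1 gtr0_norm.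
    by rewrite mulr0 normr0 ltW.
  have dh p : dotr p h = p 0 i * c.
    rewrite /dotr (bigD1 i)//= big1 => [|j ji]; first by rewrite !mxE !eqxx mulr1 addr0.
    by rewrite !mxE (negbTE ji) andbF !mulr0.
  have hm : `|h| < Num.min d1 d2 by exact: le_lt_trans hc cm.
  move: (hm); rewrite lt_min => /andP[hd1 hd2].
  have a1 : `|u (x + h) - u x - q k 0 i * c| <= k.+1%:R^-1 * c.
    by rewrite -dh; apply: le_trans (h1 h I hd1) _; rewrite ler_wpM2l ?invr_ge0.
  have a2 : `|u (x + h) - u x - q l 0 i * c| <= l.+1%:R^-1 * c.
    by rewrite -dh; apply: le_trans (h2 h I hd2) _; rewrite ler_wpM2l ?invr_ge0.
  rewrite -(ler_pM2r c0) mulrBl mulrDl.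
  have close (a b b' r r' : R) : `|a - b| <= r -> `|a - b'| <= r' -> b - r <= b' + r'.
    by rewrite !ler_norml => /andP[? ?] /andP[? ?]; lra.
  exact: close a1 a2.
(* By [qq] the intervals of radius [1/(k+1)] around the [i]-th components meet pairwise; the
   supremum of their left ends lies in all of them. *)
pose p : 'rV[R]_n := \row_i sup [set q k 0 i - k.+1%:R^-1 | k in setT].
have pq k i : `|p 0 i - q k 0 i| <= k.+1%:R^-1.
  rewrite mxE ler_norml; apply/andP; split.
    rewrite lerBrDl; apply: ub_le_sup; last by exists k.
    by exists (q 0%N 0 i + 1%:R^-1) => _ [l _ <-]; exact: qq.
  rewrite lerBlDl; apply: ge_sup; first by exists (q k 0 i - k.+1%:R^-1), k.
  by move=> _ [l _ <-]; exact: qq.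
exists p => e e0.
have n0 : 0 < n.+1%:R :> R by [].
(* One [1/(k+1)] comes from the approximation by [q k] and [n] of them from replacing [q k] by
   [p]. *)
have [k ke] := natSinv_lt (divr_gt0 e0 n0).
have [d [d0 hd]] := hq k; exists d; split=> // h hh.
have -> : u (x + h) - u x - dotr p h = (u (x + h) - u x - dotr (q k) h) + dotr (q k - p) h.
  by rewrite dotrDl dotrNl; ring.
apply: le_trans (ler_normD _ _) _.
apply: (@le_trans _ _ (k.+1%:R^-1 * `|h| + n%:R * k.+1%:R^-1 * `|h|)).
  apply: lerD; first exact: hd.
  by apply: le_dotr => i; rewrite !mxE distrC; have := pq k i; rewrite mxE.
rewrite -mulrDl ler_wpM2r// -{1}[_^-1]mul1r -mulrDl nat1r mulrC -ler_pdivlMr//.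
exact: ltW.
Qed.

Lemma approx_diffP n (u : 'rV[R]_n -> R) x : approx_diff u setT x <-> differentiable u x.
Proof.
split=> [/approx_has_grad[q /has_grad_diff[]]//|/diff_has_grad]; exact: has_grad_approx.
Qed.

(** The affine relation is only local: this is the form taken by truncations and absolute values
    away from the level at which they switch. *)
Lemma has_grad_affine n (u v : 'rV[R]_n -> R) (a b : R) x q :
  (exists2 d, 0 < d & forall h, `|h| < d -> v (x + h) = a * u (x + h) + b) ->
  has_grad u x q -> has_grad v x (a *: q).
Proof.
move=> [d1 d10 hv] hq e e0.
have a0 : 0 < `|a| + 1 by rewrite ltr_wpDl.
have [|d2 [d20 hd]] := hq (e / (`|a| + 1)); first by rewrite divr_gt0.
exists (Num.min d1 d2); rewrite lt_min d10 d20; split=> // h.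
rewrite lt_min => /andP[h1 h2].
have v0 : v x = a * u x + b by have := hv 0; rewrite addr0 normr0; exact.
rewrite hv// v0.
have -> : dotr (a *: q) h = a * dotr q h.
  by rewrite /dotr mulr_sumr; apply: eq_bigr => i _; rewrite mxE mulrA.
have -> : a * u (x + h) + b - (a * u x + b) - a * dotr q h =
   a * (u (x + h) - u x - dotr q h) by ring.
rewrite normrM; apply: (@le_trans _ _ (`|a| * (e / (`|a| + 1) * `|h|))).
  by rewrite ler_wpM2l// hd.
rewrite mulrA ler_wpM2r// mulrCA -[leRHS]mulr1 ler_wpM2l// ?(ltW e0)//.
by rewrite ler_pdivrMr// mul1r lerDl.
Qed.

Lemma enorm_ge0 n (x : 'rV[R]_n) : 0 <= enorm x.
Proof. exact: sqrtr_ge0. Qed.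

Lemma enorm_sqr n (x : 'rV[R]_n) : enorm x ^+ 2 = \sum_i x 0 i ^+ 2.
Proof. by rewrite sqr_sqrtr// sumr_ge0// => i _; rewrite sqr_ge0. Qed.

Lemma enormZ n a (x : 'rV[R]_n) : enorm (a *: x) = `|a| * enorm x.
Proof.
rewrite /enorm -sqrtr_sqr -sqrtrM ?sqr_ge0//; congr Num.sqrt.
by rewrite mulr_sumr; apply: eq_bigr => i _; rewrite mxE exprMn.
Qed.

Lemma enorm_le n (x : 'rV[R]_n) c : 0 <= c -> (forall i, `|x 0 i| <= c) ->
  enorm x <= n%:R * c.
Proof.
move=> c0 h; rewrite -(@ler_pXn2r _ 2)// ?nnegrE ?enorm_ge0 ?mulr_ge0//.
rewrite enorm_sqr; apply: (@le_trans _ _ (\sum_(i < n) c ^+ 2)).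
  by apply: ler_sum => i _; rewrite -real_normK ?num_real// lerXn2r ?nnegrE.
rewrite sumr_const card_ord -[leLHS]mulr_natl exprMn ler_wpM2r ?sqr_ge0//.
by rewrite -natrX ler_nat; case: (n) => // m; rewrite -{1}(expn1 m.+1) leq_pexp2l.
Qed.

Lemma normr_enorm n (x : 'rV[R]_n) : `|x| <= enorm x.
Proof.
apply: rV_normr_le => [|j]; first exact: enorm_ge0.
rewrite -(@ler_pXn2r _ 2)// ?nnegrE ?enorm_ge0// enorm_sqr real_normK ?num_real//.
by rewrite (bigD1 j)//= lerDl sumr_ge0// => i _; rewrite sqr_ge0.
Qed.

Lemma enorm_normr n (x : 'rV[R]_n) : enorm x <= n%:R * `|x|.
Proof. by apply: enorm_le => // i; exact: normr_coord. Qed.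

Lemma gradnorm_ge0 n (u : 'rV[R]_n -> R) x : 0 <= gradnorm u x.
Proof. by rewrite /gradnorm; case: asboolP => // _; exact: enorm_ge0. Qed.

Lemma gradnorm_affine n (u v : 'rV[R]_n -> R) (a b : R) x :
  (exists2 d, 0 < d & forall h, `|h| < d -> v (x + h) = a * u (x + h) + b) ->
  differentiable u x -> gradnorm v x = `|a| * gradnorm u x.
Proof.
move=> uv /diff_has_grad hq.
by rewrite (gradnormE hq) (gradnormE (has_grad_affine uv hq)) enormZ.
Qed.

Lemma gradnorm_locally_cst n (v : 'rV[R]_n -> R) (b : R) x :
  (exists2 d, 0 < d & forall h, `|h| < d -> v (x + h) = b) -> gradnorm v x = 0.
Proof.
move=> [d d0 h].
have h0 : has_grad (fun=> 0 : R) x 0.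
  move=> e e0; exists 1; split=> // k _.
  rewrite /dotr big1 => [|i _]; last by rewrite mxE mul0r.
  by rewrite !subrr normr0 mulr_ge0// ltW.
rewrite (@gradnorm_affine _ (fun=> 0) _ 0 b); first by rewrite normr0 mul0r.
- by exists d => // k kd; rewrite h// mul0r add0r.
- exact: (has_grad_diff h0).1.
Qed.

(** With a gradient [q] other than 0, a small step along [- q] would decrease [v]; without a
    gradient, [gradnorm] is 0 by convention. *)
Lemma gradnorm_min n (v : 'rV[R]_n -> R) x : (forall y, v x <= v y) -> gradnorm v x = 0.
Proof.
move=> vmin; rewrite /gradnorm; case: asboolP => // /diff_has_grad.
move: (\row_i partial v i x) => q hq.
suff q0 : q = 0.
  by rewrite q0 /enorm big1 ?sqrtr0// => i _; rewrite mxE expr0n.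
have qq : dotr q q <= 0.
  rewrite leNgt; apply/negP => qq0.
  have q0 : 0 < `|q|.
    rewrite normr_gt0; apply: contraTneq qq0 => ->.
    by rewrite /dotr big1 ?ltxx// => i _; rewrite mxE mul0r.
  (* With this tolerance the error on the increment [- s q] is half of the decrease [s (q . q)]. *)
  have [|d [d0 hd]] := hq (dotr q q / (2 * `|q|)); first by rewrite divr_gt0// mulr_gt0.
  pose s := d / (2 * `|q|).
  have s0 : 0 < s by rewrite divr_gt0// mulr_gt0.
  have sq : `|- s *: q| = s * `|q| by rewrite normrZ normrN gtr0_norm.
  have sqd : `|- s *: q| < d.
    rewrite sq /s invfM mulrA divfK ?gt_eqF// ltr_pdivrMr// ltr_pMr// ltr1n//.
  have := hd _ sqd; rewrite sq dotrZr => h.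
  have vm := vmin (x + - s *: q).
  have : dotr q q / (2 * `|q|) * (s * `|q|) = s * dotr q q / 2.
    by field; rewrite gt_eqF.
  move=> E; rewrite E in h; move: h; rewrite ler_norml => /andP[_ h].
  have sp : 0 < s * dotr q q by rewrite mulr_gt0.
  by lra.
apply/rowP => i; rewrite mxE; apply/eqP; rewrite -sqrf_eq0 eq_le sqr_ge0 andbT.
apply: le_trans qq; rewrite /dotr (bigD1 i)//= expr2 lerDl sumr_ge0// => j _.
by rewrite -expr2 sqr_ge0.
Qed.

End differentiability.

(** * Bounds and measurability of the gradient *)

Section gradnorm_measurable.
Variable R : realType.

Lemma lipschitz_lipr n (u : 'rV[R]_n -> R) : lipschitz_fun u ->
  exists L, 0 <= L /\ lipr u L.
Proof.
move=> [L uL]; exists (`|L| * n%:R); split; first by rewrite mulr_ge0.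
move=> x y; apply: le_trans (uL x y) _.
apply: (@le_trans _ _ (`|L| * enorm (x - y))).
  by rewrite ler_wpM2r ?enorm_ge0// ler_norm.
by rewrite -mulrA ler_wpM2l// enorm_normr.
Qed.

Lemma lipr_lipschitz n (u : 'rV[R]_n -> R) L : lipr u L -> lipschitz_fun u.
Proof.
move=> uL; exists `|L| => x y; apply: le_trans (uL x y) _.
apply: (@le_trans _ _ (`|L| * `|x - y|)); first by rewrite ler_wpM2r// ler_norm.
by rewrite ler_wpM2l// normr_enorm.
Qed.

Lemma normr_delta n c (i : 'I_n) : `|c *: delta_mx 0 i : 'rV[R]_n| = `|c|.
Proof.
rewrite normrZ -[RHS]mulr1; congr (_ * _); apply/eqP; rewrite eq_le; apply/andP; split.
  apply: rV_normr_le => // j; rewrite mxE eqxx/=.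
  by case: eqP => _; rewrite ?normr1// normr0.
by have := normr_coord (delta_mx 0 i : 'rV[R]_n) i; rewrite mxE !eqxx normr1.
Qed.

Lemma dotr_delta n (q : 'rV[R]_n) c i : dotr q (c *: delta_mx 0 i) = c * q 0 i.
Proof.
rewrite /dotr (bigD1 i)//= big1 => [|j ji]; first by rewrite !mxE !eqxx mulr1 addr0 mulrC.
by rewrite !mxE (negbTE ji) andbF !mulr0.
Qed.

Lemma lipr_has_grad_le n (u : 'rV[R]_n -> R) L x q i : 0 <= L -> lipr u L ->
  has_grad u x q -> `|q 0 i| <= L.
Proof.
move=> L0 uL hq; apply/ler_addgt0Pr => e e0; have [d [d0 hd]] := hq e e0.
have d2 : 0 < d / 2 by rewrite divr_gt0.
have hn : `|(d / 2) *: delta_mx 0 i : 'rV[R]_n| = d / 2 by rewrite normr_delta gtr0_norm.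
have := hd ((d / 2) *: delta_mx 0 i); rewrite hn dotr_delta.
rewrite ltr_pdivrMr// ltr_pMr// ltr1n => /(_ isT).
have := uL (x + (d / 2) *: delta_mx 0 i) x; rewrite addrAC subrr add0r hn.
move: (u _ - u _) => A; move=> h1 h2.
rewrite -(ler_pM2l d2) -[X in X * _](gtr0_norm d2) -normrM.
move: h1 h2; rewrite !ler_norml => /andP[? ?] /andP[? ?].
by apply/andP; split; lra.
Qed.

(** The value 0 at points without a differential matches the convention of [gradnorm] and makes the
    function measurable and bounded for Lipschitz [u]. *)
Definition dpart n (u : 'rV[R]_n -> R) (i : 'I_n) (x : 'rV[R]_n) : R :=
  if `[< differentiable u x >] then partial u i x else 0.

Lemma gradnorm_dpart n (u : 'rV[R]_n -> R) x :
  gradnorm u x = enorm (\row_i dpart u i x).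
Proof.
rewrite /gradnorm; case: asboolP => dx.
  by congr enorm; apply/rowP => i; rewrite !mxE /dpart; case: asboolP.
rewrite /enorm big1 ?sqrtr0// => i _; rewrite mxE /dpart.
by case: asboolP => // _; rewrite expr0n.
Qed.

Lemma lipr_dpart_le n (u : 'rV[R]_n -> R) L x i : 0 <= L -> lipr u L ->
  `|dpart u i x| <= L.
Proof.
move=> L0 uL; rewrite /dpart; case: asboolP => [dx|_]; last by rewrite normr0.
have := lipr_has_grad_le i L0 uL (diff_has_grad dx).
by rewrite mxE.
Qed.

Lemma lipr_gradnorm_le n (u : 'rV[R]_n -> R) L x : 0 <= L -> lipr u L ->
  gradnorm u x <= n%:R * L.
Proof.
move=> L0 uL; rewrite gradnorm_dpart; apply: enorm_le => // i; rewrite mxE.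
exact: lipr_dpart_le.
Qed.

Lemma measurable_differentiable n (u : 'rV[R]_n -> R) : continuous u ->
  measurable (@vec R n @^-1` [set x | differentiable u x]).
Proof.
move=> cu; have -> : [set x | differentiable u x] = approx_diff u setT.
  by apply/seteqP; split=> x /=; rewrite approx_diffP.
exact: measurable_approx_diff.
Qed.

(** The steps [1/(k+1)] give a sequence, as required for the measurability of the limit and for
    dominated convergence. *)
Lemma has_grad_quotient_cvg n (u : 'rV[R]_n -> R) x q e : has_grad u x q ->
  (fun k : nat => k.+1%:R * (u (x + k.+1%:R^-1 *: e) - u x)) @ \oo --> dotr q e.
Proof.
move=> hq; apply/cvgrPdist_le => eps eps0.
have c0 : 0 < `|e| + 1 by rewrite ltr_wpDl.
have [|d [d0 hd]] := hq (eps / (`|e| + 1)); first by rewrite divr_gt0.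
near=> k.
have k0 : 0 < k.+1%:R :> R by [].
have ke : `|k.+1%:R^-1 *: e| = k.+1%:R^-1 * `|e| by rewrite normrZ gtr0_norm// invr_gt0.
have kd : k.+1%:R^-1 * `|e| < d.
  apply: (@le_lt_trans _ _ (k.+1%:R^-1 * (`|e| + 1))).
    by rewrite ler_wpM2l ?invr_ge0// lerDl.
  rewrite -ltr_pdivlMr//; near: k.
  exact: (near_infty_natSinv_lt (PosNum (divr_gt0 d0 c0))).
have := hd (k.+1%:R^-1 *: e); rewrite ke => /(_ kd).
rewrite dotrZr -(ler_pM2l k0) -{1}(gtr0_norm k0) -normrM distrC.
have -> : k.+1%:R * (u (x + k.+1%:R^-1 *: e) - u x - k.+1%:R^-1 * dotr q e) =
   k.+1%:R * (u (x + k.+1%:R^-1 *: e) - u x) - dotr q e.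
  by field; rewrite gt_eqF.
move=> h; rewrite distrC in h; rewrite distrC; apply: le_trans h _.
have -> : k.+1%:R * (eps / (`|e| + 1) * (k.+1%:R^-1 * `|e|)) = eps / (`|e| + 1) * `|e|.
  by field; rewrite !gt_eqF.
rewrite -mulrA -[leRHS]mulr1 ler_wpM2l// ?(ltW eps0)// mulrC.
by rewrite ler_pdivrMr// mul1r lerDl.
Unshelve. all: by end_near. Qed.

Lemma measurable_dpart n (u : 'rV[R]_n -> R) i : continuous u ->
  measurable_fun setT (dpart u i \o @vec R n).
Proof.
move=> cu; pose D := @vec R n @^-1` [set x | differentiable u x].
have mD : measurable D by exact: measurable_differentiable.
(* The indicator makes the quotients converge, to 0, also where [u] is not differentiable. *)
pose g (k : nat) z := \1_D z *
  (k.+1%:R * (u (vec z + k.+1%:R^-1 *: delta_mx 0 i) - u (vec z))).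
apply: (@measurable_fun_cvg _ _ _ _ g).
  move=> k; apply: measurable_funM => //; apply: measurable_funM => //.
  apply: measurable_funB; last exact: rV_continuous_measurable.
  have c := @continuous_shiftf R 'rV[R]_n u (k.+1%:R^-1 *: delta_mx 0 i) cu.
  have := rV_continuous_measurable c.
  exact.
move=> z _; rewrite /g /dpart /= indicE; case: asboolP => dz.
  rewrite mem_set//; under eq_fun do rewrite mul1r.
  have -> : partial u i (vec z) = dotr (\row_i partial u i (vec z)) (delta_mx 0 i).
    by rewrite -diff_partial.
  exact/has_grad_quotient_cvg/diff_has_grad.
rewrite memNset//; under eq_fun do rewrite mul0r.
exact: cvg_cst.
Qed.

Lemma measurable_gradnorm n (u : 'rV[R]_n -> R) : continuous u ->
  measurable_fun setT (gradnorm u \o @vec R n).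
Proof.
move=> cu.
have -> : gradnorm u \o @vec R n = Num.sqrt \o (fun z => \sum_i (dpart u i (vec z)) ^+ 2).
  apply/funext => z; rewrite /= gradnorm_dpart /enorm; congr Num.sqrt.
  by apply: eq_bigr => i _; rewrite mxE.
apply: measurableT_comp; first by apply: continuous_measurable_fun; exact: sqrt_continuous.
apply: measurable_sum => i; apply: measurable_funX; exact: measurable_dpart.
Qed.

Lemma ae_differentiable n (u : 'rV[R]_n -> R) L : lipr u L ->
  {ae mu R n, forall z, differentiable u (vec z)}.
Proof.
move=> uL; exists (@vec R n @^-1` (~` approx_diff u setT)); split.
- rewrite -preimage_setC; apply: measurableC; apply: measurable_approx_diff.
  exact: lipr_continuous uL.
- exact: rademacher uL.
- by move=> z /=; apply: contra_not; rewrite approx_diffP.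
Qed.

Lemma gradnorm_supp n (u : 'rV[R]_n -> R) M x : (forall x, M < `|x| -> u x = 0) ->
  M < `|x| -> gradnorm u x = 0.
Proof.
move=> u0 Mx; apply: (@gradnorm_locally_cst _ _ _ 0).
exists (`|x| - M); first by rewrite subr_gt0.
move=> h hx; apply: u0; have := ler_normD (x + h) (- h).
rewrite addrK normrN; lra.
Qed.

Lemma bfun_gradnorm n (u : 'rV[R]_n -> R) L M : lipr u L ->
  (forall x, M < `|x| -> u x = 0) -> bfun (gradnorm u).
Proof.
move=> uL u0; split; first exact/measurable_gradnorm/(lipr_continuous uL).
exists (Num.max M (n%:R * `|L|)); split=> [x|x]; last first.
  by rewrite gt_max => /andP[Mx _]; exact: gradnorm_supp Mx.
rewrite ger0_norm ?gradnorm_ge0// le_max (@lipr_gradnorm_le _ _ `|L|) ?orbT//.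
by move=> y z; apply: le_trans (uL y z) _; rewrite ler_wpM2r// ler_norm.
Qed.

Lemma bfun_lipr n (u : 'rV[R]_n -> R) L M : lipr u L ->
  (forall x, M < `|x| -> u x = 0) -> bfun u.
Proof.
move=> uL u0; split; first exact/rV_continuous_measurable/(lipr_continuous uL).
exists (Num.max M (`|L| * (`|M| + 1) + `|u 0|)); split=> [x|x]; last first.
  by rewrite gt_max => /andP[Mx _]; exact: u0.
rewrite le_max; have [Mx|xM] := ltP M `|x|.
  by rewrite u0// normr0 (addr_ge0 _ _) ?orbT// mulr_ge0// addr_ge0.
apply/orP; right; have -> : u x = (u x - u 0) + u 0 by rewrite subrK.
apply: le_trans (ler_normD _ _) _; rewrite lerD2r.
apply: le_trans (uL x 0) _; rewrite subr0.
apply: (@le_trans _ _ (`|L| * `|x|)); first by rewrite ler_wpM2r// ler_norm.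
by rewrite ler_wpM2l// (le_trans xM)// (le_trans (ler_norm _))// lerDl.
Qed.

End gradnorm_measurable.

(** * Mollification *)

Section convolution.
Variable R : realType.

Lemma bfunM n (g h : 'rV[R]_n -> R) : bfun g -> bfun h -> bfun (fun x => g x * h x).
Proof.
move=> [mg [M [gM g0]]] [mh [N [hN h0]]]; split; first exact: measurable_funM.
have M0 : 0 <= M by exact: le_trans (gM 0).
have N0 : 0 <= N by exact: le_trans (hN 0).
exists (M * N + M); split=> [x|x hx].
  by rewrite normrM (@le_trans _ _ (M * N)) ?lerDl// ler_pM.
by rewrite g0 ?mul0r// (le_lt_trans _ hx)// lerDr mulr_ge0.
Qed.

Lemma bfunD n (g h : 'rV[R]_n -> R) : bfun g -> bfun h -> bfun (fun x => g x + h x).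
Proof.
move=> bg bh; have := bfunB bg (bfunZ (-1) bh).
by congr bfun; apply/funext => x; rewrite mulN1r opprK.
Qed.

Lemma bfun0 n : bfun (fun _ : 'rV[R]_n => 0 : R).
Proof. by split; [exact: measurable_cst|exists 0; split=> // x; rewrite normr0]. Qed.

Lemma JD n (g h : 'rV[R]_n -> R) : bfun g -> bfun h ->
  J (fun x => g x + h x) = J g + J h.
Proof.
move=> bg bh; have := JB bg (bfunZ (-1) bh); rewrite JZ// mulN1r opprK => <-.
by congr J; apply/funext => x; rewrite mulN1r opprK.
Qed.

Lemma J0 n : J (fun _ : 'rV[R]_n => 0 : R) = 0.
Proof. by rewrite /J /Rintegral integral0. Qed.

Lemma bfun_sum n (I : Type) (s : seq I) (g : I -> 'rV[R]_n -> R) :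
  (forall i, bfun (g i)) -> bfun (fun x => \sum_(i <- s) g i x).
Proof.
move=> bg; elim: s => [|i s IH].
  by under eq_fun do rewrite big_nil; exact: bfun0.
by under eq_fun do rewrite big_cons; exact: bfunD.
Qed.

Lemma J_sum n (I : Type) (s : seq I) (g : I -> 'rV[R]_n -> R) :
  (forall i, bfun (g i)) -> J (fun x => \sum_(i <- s) g i x) = \sum_(i <- s) J (g i).
Proof.
move=> bg; elim: s => [|i s IH].
  by under eq_fun do rewrite big_nil; rewrite big_nil J0.
under eq_fun do rewrite big_cons; rewrite big_cons -IH JD//.
exact: bfun_sum.
Qed.

Lemma le_normr_J n (g h : 'rV[R]_n -> R) : bfun g -> bfun h ->
  (forall x, `|g x| <= h x) -> `|J g| <= J h.
Proof.
move=> bg bh gh; rewrite ler_norml; apply/andP; split.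
  have := @le_J _ _ (fun x => -1 * h x) g; rewrite JZ// mulN1r; apply=> //.
    exact: bfunZ.
  by move=> x; rewrite mulN1r lerNl (le_trans _ (gh x))// -normrN ler_norm.
by apply: le_J => // x; rewrite (le_trans _ (gh x))// ler_norm.
Qed.

Lemma bfun_shift n (g : 'rV[R]_n -> R) (y : 'rV[R]_n) : bfun g -> bfun (fun x => g (x + y)).
Proof.
move=> [mg [M [gM g0]]]; split.
  have -> : (fun x => g (x + y)) \o @vec R n = (g \o @vec R n) \o (fun z => spD z (unvec y)).
    by apply/funext => z /=; rewrite vecD unvecK.
  by apply: measurableT_comp => //; exact: measurable_spD.
exists (M + `|y|); split=> [x|x Mx].
  by rewrite (le_trans (gM _))// lerDl.
apply: g0; rewrite -(ltrD2r `|y|) (lt_le_trans Mx)//.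
by have := ler_normD (x + y) (- y); rewrite addrK normrN.
Qed.

Lemma J_shift n (g : 'rV[R]_n -> R) (y : 'rV[R]_n) : bfun g ->
  J (fun x => g (x + y)) = J g.
Proof.
move=> bg; have [mg _] := bg; apply: EFin_inj; rewrite !EFin_J//; last exact: bfun_shift.
rewrite integralE [RHS]integralE.
have mE : measurable_fun setT ((EFin \o g) \o @vec R n) by exact/measurable_EFinP.
congr (_ - _)%E.
  under eq_integral do rewrite funeposE; under [RHS]eq_integral do rewrite funeposE.
  apply: (@ge0_integral_vec_shift _ _ (fun x => maxe (g x)%:E 0%E)).
    by apply: measurable_maxe => //; exact: mE.
  by move=> x; rewrite le_max lexx orbT.
under eq_integral do rewrite funenegE; under [RHS]eq_integral do rewrite funenegE.
apply: (@ge0_integral_vec_shift _ _ (fun x => maxe (- (g x)%:E)%E 0%E)).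
  by apply: measurable_maxe => //; exact: (measurableT_comp _ mE).
by move=> x; rewrite le_max lexx orbT.
Qed.

(** Written as a correlation; for the even kernel [moll] it is the usual convolution, and it is an
    average of translates of [F]. *)
Definition convol n (F e : 'rV[R]_n -> R) (x : 'rV[R]_n) : R :=
  J (fun y => F (y + x) * e y).

(** Tonelli's theorem: integrating in [x] first, the inner integral is [J F] for each [y], by
    translation invariance. *)
Lemma conv_measurable n (F e : 'rV[R]_n -> R) : bfun F -> bfun e ->
  (forall x, 0 <= F x) -> (forall x, 0 <= e x) ->
  measurable_fun setT (convol F e \o @vec R n) /\
  (\int[mu R n]_x (convol F e (vec x))%:E)%E = (J F * J e)%:E.
Proof.
move=> bF be F0 e0.
pose H (p : sp R n * sp R n) : \bar R := (F (vec p.2 + vec p.1) * e (vec p.2))%:E.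
have mF : measurable_fun setT (fun p : sp R n * sp R n => F (vec p.2 + vec p.1)).
  have -> : (fun p : sp R n * sp R n => F (vec p.2 + vec p.1)) =
      (F \o @vec R n) \o (fun p => spD p.2 p.1).
    by apply/funext => p /=; rewrite vecD.
  by apply: measurableT_comp; [exact: bF.1|exact: measurable_spD].
have me : measurable_fun setT (fun p : sp R n * sp R n => e (vec p.2)).
  by apply: (@measurableT_comp _ _ _ _ _ _ (e \o @vec R n) _ snd) => //; exact: be.1.
have mH : measurable_fun setT H by apply/measurable_EFinP; exact: measurable_funM.
have H0 p : (0 <= H p)%E by rewrite lee_fin mulr_ge0.
have bFe x : bfun (fun y => F (y + x) * e y) by apply: bfunM => //; exact: bfun_shift.
have cE x : (convol F e (vec x))%:E = (\int[mu R n]_y H (x, y))%E.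
  by rewrite /convol EFin_J.
split.
  apply/measurable_EFinP; rewrite (_ : _ \o _ = fubini_F (mu R n) H).
    exact: measurable_fun_fubini_tonelli_F.
  by apply/funext => x /=; rewrite cE.
under eq_integral do rewrite cE.
rewrite (fubini_tonelli H)//.
transitivity (\int[mu R n]_y ((J F)%:E * (e (vec y))%:E))%E.
  apply: eq_integral => y _; rewrite /H/=.
  under eq_integral do rewrite EFinM (addrC (vec y)).
  rewrite ge0_integralZr//; last 3 first.
  - by apply/measurable_EFinP; exact: (bfun_shift (vec y) bF).1.
  - by move=> x _; rewrite lee_fin.
  - by rewrite lee_fin.
  congr (_ * _)%E; rewrite EFin_J//.
  apply: (@ge0_integral_vec_shift _ _ (fun x => (F x)%:E)) => //.
    by apply/measurable_EFinP; exact: bF.1.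
rewrite ge0_integralZl//; [|by apply/measurable_EFinP; exact: be.1|
  by move=> x _; rewrite lee_fin|by rewrite lee_fin J_ge0].
by rewrite -EFin_J// EFinM.
Qed.

Lemma bfun_conv n (F e : 'rV[R]_n -> R) : bfun F -> bfun e ->
  (forall x, 0 <= F x) -> (forall x, 0 <= e x) -> bfun (convol F e).
Proof.
move=> bF be F0 e0; split; first exact: (conv_measurable bF be F0 e0).1.
have [_ [M [FM F00]]] := bF; have [_ [N [eN e00]]] := be.
have M0 : 0 <= M by exact: le_trans (FM 0).
have N0 : 0 <= N by exact: le_trans (eN 0).
have J0e : 0 <= J e by exact: J_ge0.
exists (M * J e + (M + N)); split=> [x|x hx].
  rewrite -[leLHS]/(`|convol F e x|).
  rewrite (@le_trans _ _ (M * J e)) ?lerDl ?addr_ge0//.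
  rewrite -JZ//; apply: le_normr_J.
  - by apply: bfunM => //; exact: bfun_shift.
  - exact: bfunZ.
  - by move=> y; rewrite normrM (ger0_norm (e0 y)) ler_wpM2r.
have MNx : M + N < `|x| by apply: le_lt_trans hx; rewrite lerDr mulr_ge0.
rewrite /convol (_ : (fun y => _) = fun=> 0) ?J0//; apply/funext => y.
have [yN|Ny] := ltP N `|y|; first by rewrite e00// mulr0.
rewrite F00 ?mul0r//; have := ler_normD (y + x) (- y).
rewrite addrAC subrr add0r normrN; lra.
Qed.

Lemma J_conv n (F e : 'rV[R]_n -> R) : bfun F -> bfun e ->
  (forall x, 0 <= F x) -> (forall x, 0 <= e x) -> J (convol F e) = J F * J e.
Proof.
move=> bF be F0 e0; apply: EFin_inj; rewrite EFin_J; last exact: bfun_conv.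
exact: (conv_measurable bF be F0 e0).2.
Qed.

(** The substitution moves [x] into the kernel, whose smoothness then passes to the convolution. *)
Lemma convE n (F e : 'rV[R]_n -> R) x : bfun F -> bfun e ->
  convol F e x = J (fun y => F y * e (y - x)).
Proof.
move=> bF be; rewrite -(@J_shift _ (fun y => F y * e (y - x)) x); last first.
  by apply: bfunM => //; exact: (bfun_shift (- x)).
by rewrite /convol; congr J; apply/funext => y; rewrite addrK.
Qed.

End convolution.

(** * The kernel and the smoothness of mollified functions *)

Section mollifier.
Variable R : realType.

Lemma continuous_sumf (T : topologicalType) n (f : 'I_n -> T -> R) :
  (forall i, continuous (f i)) -> continuous (fun x => \sum_i f i x).
Proof.
elim: n f => [|n IH] f cf.
  by under eq_fun do rewrite big_ord0; exact: cst_continuous.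
under eq_fun do rewrite big_ord_recl.
by move=> x; apply: cvgD; [exact: cf|exact: IH].
Qed.

Lemma continuous_mulf (T : topologicalType) (f g : T -> R) :
  continuous f -> continuous g -> continuous (fun x => f x * g x).
Proof. by move=> cf cg x; apply: cvgM; [exact: cf|exact: cg]. Qed.

Lemma continuous_maxf (T : topologicalType) (f g : T -> R) :
  continuous f -> continuous g -> continuous (fun x => Num.max (f x) (g x)).
Proof. by move=> cf cg x; apply: continuous_max; [exact: cf|exact: cg]. Qed.

Variables (n : nat) (r : R).
Hypothesis r0 : 0 < r.

Definition mcap (y : 'rV[R]_n) : R := Num.max 0 (r ^+ 2 - dotr y y).

(* A compactly supported function of class C^{1,1} is enough for mollification. *)
Definition moll (y : 'rV[R]_n) : R := mcap y ^+ 2.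

(** Minus the [i]-th partial derivative of [moll]; the sign is that of differentiating
    [moll (y - x)] in [x]. *)
Definition dmoll (i : 'I_n) (y : 'rV[R]_n) : R := 4 * mcap y * y 0 i.

Lemma mcap_ge0 y : 0 <= mcap y.
Proof. by rewrite /mcap le_max lexx. Qed.

Lemma mcap_le y : mcap y <= r ^+ 2.
Proof.
rewrite ge_max sqr_ge0/= lerBlDr lerDl sumr_ge0// => i _.
by rewrite -expr2 sqr_ge0.
Qed.

Lemma moll_ge0 y : 0 <= moll y.
Proof. exact: sqr_ge0. Qed.

Lemma dotr_enorm (y : 'rV[R]_n) : dotr y y = enorm y ^+ 2.
Proof. by rewrite enorm_sqr /dotr; apply: eq_bigr => i _; rewrite expr2. Qed.

Lemma mcap_supp y : r < `|y| -> mcap y = 0.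
Proof.
move=> ry; apply/max_idPl; rewrite subr_le0 dotr_enorm lerXn2r ?nnegrE ?enorm_ge0//.
  exact: ltW.
exact: le_trans (ltW ry) (normr_enorm _).
Qed.

Lemma continuous_mcap : continuous mcap.
Proof.
apply: continuous_maxf; first exact: cst_continuous.
apply: continuous_subf; first exact: cst_continuous.
by apply: continuous_sumf => i; apply: continuous_mulf; exact: coord_continuous.
Qed.

Lemma continuous_moll : continuous moll.
Proof. exact: (continuous_mulf continuous_mcap continuous_mcap). Qed.

Lemma bfun_moll : bfun moll.
Proof.
split; first exact/rV_continuous_measurable/continuous_moll.
exists (Num.max r ((r ^+ 2) ^+ 2)); split=> [y|y].
  rewrite ger0_norm ?moll_ge0// le_max; apply/orP; right.
  by rewrite lerXn2r ?nnegrE ?mcap_ge0 ?sqr_ge0// mcap_le.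
by rewrite gt_max => /andP[ry _]; rewrite /moll mcap_supp// expr0n.
Qed.

(** The kernel is not normalized: its mass appears on both sides of the final inequality and is
    cancelled there. *)
Lemma J_moll_gt0 : 0 < J moll.
Proof.
apply: (J_gt0 bfun_moll continuous_moll moll_ge0); exists 0.
rewrite /moll /mcap; have -> : dotr (0 : 'rV[R]_n) 0 = 0.
  by rewrite /dotr big1// => i _; rewrite mxE mul0r.
by rewrite subr0 max_r ?sqr_ge0// expf_neq0// expf_neq0// gt_eqF.
Qed.

Lemma bfun_dmoll i : bfun (dmoll i).
Proof.
split.
  apply: rV_continuous_measurable; apply: continuous_mulf; last exact: coord_continuous.
  by apply: continuous_mulf; [exact: cst_continuous|exact: continuous_mcap].
exists (Num.max r (4 * r ^+ 2 * r)); split=> [y|y].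
  have [ry|yr] := ltP r `|y|.
    by rewrite /dmoll mcap_supp// mulr0 mul0r normr0 le_max (ltW r0).
  rewrite le_max; apply/orP; right; rewrite !normrM (ger0_norm (mcap_ge0 _)).
  rewrite ger0_norm// ler_pM// ?mulr_ge0 ?mcap_ge0//.
    by rewrite ler_wpM2l// mcap_le.
  exact: le_trans (normr_coord _ _) yr.
by rewrite gt_max => /andP[ry _]; rewrite /dmoll mcap_supp// mulr0 mul0r.
Qed.

(** Taylor's formula for the square of the positive part, whose derivative is 2-Lipschitz. *)
Lemma sqr_max_rem (s d : R) :
  `|Num.max 0 (s - d) ^+ 2 - Num.max 0 s ^+ 2 + 2 * Num.max 0 s * d| <= d ^+ 2.
Proof.
have [s0|s0] := leP 0 s; have [sd|sd] := leP 0 (s - d); rewrite ler_norml;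
  apply/andP; split; nra.
Qed.

(** Let [d] be the increment of [|y|^2]. The square of the positive part leaves a remainder [d^2],
    giving the first constant; the quadratic term [|h|^2] in [d], multiplied by [2 mcap y], gives
    the second. *)
Lemma moll_rem (B : R) (y h : 'rV[R]_n) : `|y| <= B -> `|h| <= 1 ->
  `|moll (y - h) - moll y - \sum_i dmoll i y * h 0 i| <=
  ((2 * n%:R * B + n%:R) ^+ 2 + 2 * r ^+ 2 * n%:R) * `|h| ^+ 2.
Proof.
move=> yB h1.
pose d := dotr (y - h) (y - h) - dotr y y.
have dE : d = dotr h h - 2 * dotr y h.
  rewrite /d /dotr mulr_sumr -!sumrB; apply: eq_bigr => i _; rewrite !mxE; ring.
have hh : `|dotr h h| <= n%:R * `|h| ^+ 2.
  by rewrite expr2 mulrA; apply: le_dotr => i; exact: normr_coord.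
have yh : `|dotr y h| <= n%:R * B * `|h|.
  by apply: le_dotr => i; exact: le_trans (normr_coord _ _) yB.
have dh : `|d| <= (2 * n%:R * B + n%:R) * `|h|.
  rewrite dE; apply: le_trans (ler_normB _ _) _.
  rewrite [leRHS]mulrDl [leRHS]addrC; apply: lerD.
    apply: le_trans hh _; rewrite ler_wpM2l// expr2 -[leRHS]mul1r.
    by rewrite ler_wpM2r.
  by rewrite normrM ger0_norm// -!mulrA ler_wpM2l// mulrA.
have -> : \sum_i dmoll i y * h 0 i = 4 * mcap y * dotr y h.
  by rewrite /dotr mulr_sumr; apply: eq_bigr => i _; rewrite /dmoll; ring.
have -> : moll (y - h) - moll y - 4 * mcap y * dotr y h =
   (moll (y - h) - moll y + 2 * mcap y * d) - 2 * mcap y * dotr h h.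
  by rewrite dE; ring.
apply: le_trans (ler_normB _ _) _; rewrite [leRHS]mulrDl; apply: lerD.
  rewrite -exprMn; apply: (@le_trans _ _ (d ^+ 2)); last first.
    rewrite -real_normK ?num_real// lerXn2r ?nnegrE//.
    exact: (le_trans (normr_ge0 _) dh).
  rewrite /moll {1}/mcap; have -> : r ^+ 2 - dotr (y - h) (y - h) = r ^+ 2 - dotr y y - d.
    by rewrite /d; ring.
  exact: sqr_max_rem.
rewrite !normrM (ger0_norm (mcap_ge0 y)) ger0_norm// -(mulrA 2 (mcap y)).
have -> : 2 * r ^+ 2 * n%:R * `|h| ^+ 2 = 2 * (r ^+ 2 * (n%:R * `|h| ^+ 2)) by ring.
rewrite ler_wpM2l//.
apply: ler_pM; [exact: mcap_ge0|by []|exact: mcap_le|exact: hh].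
Qed.

Section convolution_with_moll.
Variables (w : 'rV[R]_n -> R) (L M : R).
Hypotheses (L0 : 0 <= L) (wL : lipr w L) (wM : forall x, M < `|x| -> w x = 0).
Hypothesis w0 : forall x, 0 <= w x.

Let bw : bfun w.
Proof. exact: bfun_lipr wL wM. Qed.

(** Differentiation under the integral by a direct estimate: [moll_rem] bounds the remainder by a
    multiple of [|h|^2] uniformly on the bounded support of [w]. *)
Lemma conv_moll_grad x :
  has_grad (convol w moll) x (\row_i J (fun y => w y * dmoll i (y - x))).
Proof.
have bb z : bfun (fun y => w y * moll (y - z)).
  by apply: bfunM => //; apply: (bfun_shift (- z)); exact: bfun_moll.
have bd i : bfun (fun y => w y * dmoll i (y - x)).
  by apply: bfunM => //; apply: (bfun_shift (- x)); exact: bfun_dmoll.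
(* The constant of [moll_rem] at [y - x], where [|y| <= M]. *)
pose C := (2 * n%:R * (`|M| + `|x|) + n%:R) ^+ 2 + 2 * r ^+ 2 * n%:R.
have C0 : 0 <= C by rewrite addr_ge0 ?sqr_ge0// mulr_ge0// mulr_ge0// ?sqr_ge0.
have Jw0 : 0 <= J w by exact: J_ge0.
have CJ0 : 0 < C * J w + 1 by rewrite ltr_wpDl// mulr_ge0.
move=> e e0; exists (Num.min 1 (e / (C * J w + 1))).
split; first by rewrite lt_min ltr01 divr_gt0.
move=> h; rewrite lt_min => /andP[h1 he].
rewrite !convE//; [|exact: bfun_moll|exact: bfun_moll].
have -> : dotr (\row_i J (fun y => w y * dmoll i (y - x))) h =
    J (fun y => \sum_i h 0 i * (w y * dmoll i (y - x))).
  rewrite (@J_sum _ _ _ _ (fun i y => h 0 i * (w y * dmoll i (y - x)))).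
    by apply: eq_bigr => i _; rewrite mxE JZ// mulrC.
  by move=> i; exact: bfunZ.
have bs : bfun (fun y => \sum_i h 0 i * (w y * dmoll i (y - x))).
  by apply: (@bfun_sum _ _ _ _ (fun i y => h 0 i * (w y * dmoll i (y - x)))) => i; exact: bfunZ.
rewrite -!JB//; [|exact: bfunB].
apply: (@le_trans _ _ (J (fun y => (C * `|h| ^+ 2) * w y))).
  apply: le_normr_J; [by apply: bfunB => //; exact: bfunB|exact: bfunZ|].
  move=> y; have -> : w y * moll (y - (x + h)) - w y * moll (y - x) -
      \sum_i h 0 i * (w y * dmoll i (y - x)) =
     w y * (moll (y - x - h) - moll (y - x) - \sum_i dmoll i (y - x) * h 0 i).
    rewrite !mulrBr opprD addrA mulr_sumr; congr (_ - _).
    by apply: eq_bigr => i _; ring.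
  rewrite normrM ger0_norm// mulrC.
  have [My|yM] := ltP M `|y|; first by rewrite wM// !mulr0.
  rewrite ler_wpM2r//; apply: moll_rem; last exact: ltW.
  rewrite (le_trans (ler_normB _ _))// lerD2r.
  exact: le_trans yM (ler_norm _).
rewrite JZ// mulrAC expr2 mulrA ler_wpM2r//.
apply: (@le_trans _ _ ((C * J w + 1) * `|h|)); first by rewrite ler_wpM2r// lerDl.
by rewrite mulrC -ler_pdivlMr// ltW.
Qed.

(** With [x] moved back into [w], the Lipschitz property of [w] makes the partial derivative
    Lipschitz. *)
Lemma continuous_partial_conv i : continuous (partial (convol w moll) i).
Proof.
have pE x : partial (convol w moll) i x = J (fun y => w (y + x) * dmoll i y).
  have := has_grad_partial (conv_moll_grad x).
  move=> /rowP/(_ i); rewrite !mxE => ->.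
  by rewrite -(convE x bw (bfun_dmoll i)).
have bwd x : bfun (fun y => w (y + x) * dmoll i y).
  by apply: bfunM; [exact: bfun_shift|exact: bfun_dmoll].
have [md [Md [dM d0]]] := bfun_dmoll i.
have ba : bfun (fun y => `|dmoll i y|).
  split; first exact: measurableT_comp md.
  by exists Md; split=> y; rewrite ?normr_id// => h; rewrite d0// normr0.
apply: (@lipr_continuous _ _ _ (L * J (fun y => `|dmoll i y|))) => x z.
rewrite !pE -JB//.
rewrite mulrAC -JZ//; apply: le_normr_J; [exact: bfunB|exact: bfunZ|].
move=> y; rewrite -mulrBl normrM ler_wpM2r//.
apply: le_trans (wL _ _) _.
by rewrite opprD addrACA subrr add0r.
Qed.

End convolution_with_moll.
End mollifier.

(** * The gradient of a mollified function *)

Section mollified_gradient.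
Variable R : realType.

(** Cauchy-Schwarz, from expanding the squared norm of [|b|^2 a - (a . b) b]. *)
Lemma le_dotr_enorm n (a b : 'rV[R]_n) : dotr a b <= enorm a * enorm b.
Proof.
have [b0|b0] := eqVneq (enorm b) 0.
  have bz i : b 0 i = 0.
    apply/eqP; rewrite -sqrf_eq0 eq_le sqr_ge0 andbT.
    have E := enorm_sqr b; apply: (@le_trans _ _ (\sum_i b 0 i ^+ 2)).
      by rewrite (bigD1 i)//= lerDl sumr_ge0// => j _; rewrite sqr_ge0.
    by rewrite -E b0 expr0n.
  by rewrite b0 mulr0 /dotr big1// => i _; rewrite bz mulr0.
have bp : 0 < enorm b by rewrite lt_def b0 enorm_ge0.
have h : 0 <= \sum_i (enorm b ^+ 2 * a 0 i - dotr a b * b 0 i) ^+ 2.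
  by apply: sumr_ge0 => i _; rewrite sqr_ge0.
have E : \sum_i (enorm b ^+ 2 * a 0 i - dotr a b * b 0 i) ^+ 2 =
    enorm b ^+ 2 * (enorm b ^+ 2 * enorm a ^+ 2 - dotr a b ^+ 2).
  transitivity (\sum_i ((enorm b ^+ 2) ^+ 2 * a 0 i ^+ 2
     - 2 * enorm b ^+ 2 * dotr a b * (a 0 i * b 0 i) + dotr a b ^+ 2 * b 0 i ^+ 2)).
    by apply: eq_bigr => i _; ring.
  rewrite big_split/= sumrB -!mulr_sumr -!enorm_sqr -/(dotr a b); ring.
rewrite E pmulr_rge0 ?exprn_gt0// subr_ge0 -exprMn in h.
have ab0 : 0 <= enorm a * enorm b by rewrite mulr_ge0 ?enorm_ge0.
apply: le_trans (ler_norm _) _.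
by rewrite -(@ler_pXn2r _ 2)// ?nnegrE// real_normK ?num_real// mulrC.
Qed.

Lemma has_grad_shift n (w : 'rV[R]_n -> R) x y q :
  has_grad (fun y => w (y + x)) y q <-> has_grad w (y + x) q.
Proof.
by split=> hq e e0; have [d [d0 hd]] := hq e e0; exists d; split=> // h /hd;
  rewrite (addrAC y).
Qed.

Lemma gradnorm_shift n (w : 'rV[R]_n -> R) x y :
  gradnorm (fun y => w (y + x)) y = gradnorm w (y + x).
Proof.
have [dw|ndw] := pselect (differentiable w (y + x)).
  have hq := diff_has_grad dw.
  by rewrite (gradnormE hq); apply: gradnormE; apply/has_grad_shift.
rewrite (gradnorm_ndiff ndw); apply: gradnorm_ndiff => /diff_has_grad/has_grad_shift.
by move=> /has_grad_diff[].
Qed.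

Lemma bfunMl n (g h : 'rV[R]_n -> R) C : measurable_fun setT (g \o @vec R n) ->
  (forall x, `|g x| <= C) -> bfun h -> bfun (fun x => g x * h x).
Proof.
move=> mg gC [mh [N [hN h0]]]; split; first exact: measurable_funM.
have C0 : 0 <= C by exact: le_trans (gC 0).
have N0 : 0 <= N by exact: le_trans (hN 0).
exists (C * N + N); split=> [x|x hx].
  by rewrite normrM (@le_trans _ _ (C * N)) ?lerDl// ler_pM.
by rewrite h0 ?mulr0// (le_lt_trans _ hx)// lerDr mulr_ge0.
Qed.

(** The square [|q|^2] is the derivative of the mollification along its own gradient [q], hence the
    average of the derivatives of [w] along [q]. By Cauchy-Schwarz these are at most [|q|] times
    [gradnorm w], and [|q|] cancels. *)
Lemma gradnorm_convol_le n (w eta : 'rV[R]_n -> R) (L M : R) x q :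
  0 <= L -> lipr w L -> (forall x, M < `|x| -> w x = 0) ->
  bfun eta -> (forall y, 0 <= eta y) ->
  has_grad (convol w eta) x q ->
  gradnorm (convol w eta) x <= convol (gradnorm w) eta x.
Proof.
move=> L0 wL wM beta eta0 hq; rewrite (gradnormE hq).
have bw : bfun w by exact: bfun_lipr wL wM.
pose wx y := w (y + x).
have wxL : lipr wx L.
  by move=> y z; apply: le_trans (wL _ _) _; rewrite opprD addrACA subrr addr0.
have cwx := lipr_continuous wxL.
have bg : bfun (gradnorm w) by exact: bfun_gradnorm wL wM.
have bge : bfun (fun y => gradnorm w (y + x) * eta y).
  exact: (bfunM (bfun_shift x bg) beta).
have c0 : 0 <= convol (gradnorm w) eta x.
  by rewrite /convol; apply: J_ge0 => y; apply: mulr_ge0; [exact: gradnorm_ge0|exact: eta0].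
have [->//|qn0] := eqVneq (enorm q) 0.
have qp : 0 < enorm q by rewrite lt_def qn0 enorm_ge0.
rewrite -(ler_pM2l qp) -expr2 -dotr_enorm.
pose F y := dotr (\row_i dpart wx i y) q * eta y.
have bF : bfun F.
  have -> : F = (fun y => \sum_i (q 0 i * (dpart wx i y * eta y))).
    apply/funext => y; rewrite /F /dotr mulr_suml; apply: eq_bigr => i _.
    by rewrite mxE; ring.
  apply: (@bfun_sum _ _ _ _ (fun i y => q 0 i * (dpart wx i y * eta y))) => i.
  apply: bfunZ; apply: (@bfunMl _ _ _ L) => //; first exact: measurable_dpart.
  by move=> y; exact: lipr_dpart_le.
have -> : dotr q q = J F.
  (* Difference quotients of [w] along [q], weighted by [eta]. Their integrals are difference
     quotients of the convolution and tend to [q . q]; almost everywhere differentiability and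
     dominated convergence identify the limit as [J F]. *)
  pose Fk (k : nat) y := k.+1%:R * (wx (y + k.+1%:R^-1 *: q) - wx y) * eta y.
  have bFk k : bfun (Fk k).
    have -> : Fk k = (fun y => k.+1%:R * (w (y + (x + k.+1%:R^-1 *: q)) * eta y
        - w (y + x) * eta y)).
      apply/funext => y; rewrite /Fk /wx (addrAC y) -(addrA y); ring.
    by apply: bfunZ; apply: bfunB; apply: bfunM => //; exact: bfun_shift.
  have Fk_cvg : (fun k => (J (Fk k))%:E) @ \oo --> (dotr q q)%:E.
    apply: cvg_EFin; first by apply: nearW.
    have := @has_grad_quotient_cvg _ _ _ _ _ q hq; apply: cvg_trans; apply: near_eq_cvg.
    apply: nearW => k /=; rewrite /convol -JB; last 2 first.
    - by apply: bfunM => //; exact: bfun_shift.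
    - by apply: bfunM => //; exact: bfun_shift.
    rewrite -JZ; last first.
      by apply: bfunB; apply: bfunM => //; exact: bfun_shift.
    congr J; apply/funext => y; rewrite /Fk /wx (addrAC y) -(addrA y); ring.
  have bdom : bfun (fun y => (L * `|q|) * eta y) by exact: bfunZ.
  have aecvg : {ae mu R n, forall z, setT z ->
      (Fk k (vec z))%:E @[k --> \oo] --> (F (vec z))%:E}.
    apply: filterS (ae_differentiable wxL) => z dz _.
    apply: cvg_EFin; first by apply: nearW.
    rewrite /F; apply: cvgM; last exact: cvg_cst.
    have -> : \row_i dpart wx i (vec z) = \row_i partial wx i (vec z).
      by apply/rowP => i; rewrite !mxE /dpart; case: asboolP.
    exact: has_grad_quotient_cvg (diff_has_grad dz).
  have dom : {ae mu R n, forall z k, setT z ->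
      (`|(Fk k (vec z))%:E| <= ((L * `|q|) * eta (vec z))%:E)%E}.
    apply: aeW => z k _; rewrite abse_EFin lee_fin /Fk normrM (ger0_norm (eta0 _)).
    rewrite ler_wpM2r// normrM ger0_norm//.
    apply: (@le_trans _ _ (k.+1%:R * (L * `|k.+1%:R^-1 *: q|))).
      by rewrite ler_wpM2l//; apply: le_trans (wxL _ _) _; rewrite addrAC subrr add0r.
    by rewrite normrZ gtr0_norm ?invr_gt0// mulrCA (mulrA k.+1%:R) divff// mul1r.
  have [_ _] := @dominated_convergence _ _ _ (mu R n) setT measurableT
    (fun k z => (Fk k (vec z))%:E) (fun z => (F (vec z))%:E)
    (fun z => ((L * `|q|) * eta (vec z))%:E)
    (fun k => proj2 (measurable_EFinP _ _) (bFk k).1)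
    (proj2 (measurable_EFinP _ _) bF.1)
    aecvg (bfun_integrable bdom) dom.
  rewrite -EFin_J//; under eq_fun do rewrite -EFin_J//.
  move=> FkF; apply: EFin_inj.
  exact: (cvg_unique _ Fk_cvg FkF).
rewrite -JZ//; apply: le_J => //; first exact: bfunZ.
move=> y; rewrite /F mulrA ler_wpM2r//.
rewrite -gradnorm_shift gradnorm_dpart mulrC.
exact: le_dotr_enorm.
Qed.

End mollified_gradient.

(** * The Poincare inequality for Lipschitz functions *)

Lemma lipr_pos (R : realType) n (v : 'rV[R]_n -> R) L a : lipr v L ->
  lipr (fun x => Num.max 0 (v x - a)) L.
Proof.
move=> vL x y; apply: le_trans (vL x y).
have [?|?] := leP 0 (v x - a); have [?|?] := leP 0 (v y - a);
  have := ler_norm (v x - v y); have := ler_norm (v y - v x);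
  rewrite (distrC (v y)) => h1 h2; rewrite ler_norml; apply/andP; split; lra.
Qed.

Lemma bfun_pos (R : realType) n (v : 'rV[R]_n -> R) L M : lipr v L ->
  (forall x, M < `|x| -> v x = 0) -> bfun (fun x => Num.max 0 (v x)).
Proof.
move=> vL vM; apply: (@bfun_lipr _ _ _ L M) => [x y|x /vM ->]; last by rewrite maxxx.
by have := lipr_pos 0 vL x y; rewrite !subr0.
Qed.

Section sobolev_approximation.
Variables (R : realType) (n : nat) (Omega : set 'rV[R]_n).
Hypothesis OmegaD : bounded_domain Omega.

Definition dom_ind (x : 'rV[R]_n) : R := if `[< Omega x >] then 1 else 0.

Lemma dom_bounded : exists M, forall x, M < `|x| -> ~ Omega x.
Proof.
have [_ [_ [_ [M hM]]]] := OmegaD; exists M => x Mx /hM.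
by apply/negP; rewrite -ltNge (lt_le_trans Mx)// normr_enorm.
Qed.

Lemma bfun_dom_ind : bfun dom_ind.
Proof.
have [M hM] := dom_bounded; split.
  have -> : dom_ind \o @vec R n = \1_(@vec R n @^-1` Omega).
    apply/funext => z; rewrite /dom_ind /= indicE; case: asboolP => h.
      by rewrite mem_set.
    by rewrite memNset.
  by apply: measurable_indic; apply: rV_open_measurable; exact: OmegaD.1.
exists (Num.max M 1); split=> [x|x].
  rewrite le_max; apply/orP; right.
  by rewrite /dom_ind; case: ifP; rewrite ?normr1 ?normr0.
by rewrite gt_max => /andP[/hM nO _]; rewrite /dom_ind; case: asboolP.
Qed.

Lemma dom_ind_ge0 x : 0 <= dom_ind x.
Proof. by rewrite /dom_ind; case: ifP. Qed.

Lemma integral_onE (g : 'rV[R]_n -> R) : bfun (fun x => dom_ind x * g x) ->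
  integral_on Omega g = (J (fun x => dom_ind x * g x))%:E.
Proof.
move=> bg; rewrite -iintE// /integral_on; congr iint; apply/funext => x.
by rewrite /dom_ind; case: ifP; rewrite ?mul1r ?mul0r.
Qed.

Lemma W1inf0_lipr v : W1inf0 Omega v -> exists L M, [/\ 0 <= L, lipr v L &
  forall x, M < `|x| -> v x = 0].
Proof.
move=> [/lipschitz_lipr[L [L0 vL]] v0]; have [M hM] := dom_bounded.
by exists L, M; split=> // x /hM; exact: v0.
Qed.

(** If [v x < d / 2], then [v] stays below [d] within distance [r] of [x] and the truncation
    vanishes there. The set where [v >= d / 2] is closed, bounded and contained in [Omega]. *)
Lemma convol_C10 (v w : 'rV[R]_n -> R) (L M d r : R) :
  0 <= L -> lipr v L -> (forall x, ~ Omega x -> v x = 0) ->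
  (forall x, M < `|x| -> v x = 0) -> 0 < d -> 0 < r -> L * r <= d / 2 ->
  w = (fun x => Num.max 0 (v x - d)) -> lipr w L ->
  C10 Omega (convol w (moll r)).
Proof.
move=> L0 vL vO vM d0 r0 Lr wE wL.
have w0 x : 0 <= w x by rewrite wE le_max lexx.
have wM x : M < `|x| -> w x = 0.
  by move=> /vM vx; rewrite wE vx sub0r max_l// oppr_le0 ltW.
split.
  by move=> x; exact: (has_grad_diff (conv_moll_grad r0 wL wM w0 x)).1.
split; first exact: (continuous_partial_conv r0 wL wM w0).
exists [set x | d / 2 <= v x]; split; last split.
- apply: bounded_closed_compact.
    exists `|M|; split => // B MB x /= dx; rewrite leNgt; apply/negP => Bx.
    move: dx; rewrite vM ?leNgt ?divr_gt0//.
    by rewrite (le_lt_trans (ler_norm _))// (lt_trans MB).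
  apply: (@preimage_closed _ _ v [set t | d / 2 <= t]); last exact: closed_ge.
  by move=> x _; exact: (lipr_continuous vL).
- move=> x /= dx; apply: contrapT => /vO vx; move: dx.
  by rewrite vx leNgt divr_gt0.
- move=> x /negP; rewrite -ltNge => vx.
  rewrite /convol (_ : (fun y => _) = fun=> 0) ?J0//; apply/funext => y.
  have [ry|yr] := ltP r `|y|; first by rewrite /moll mcap_supp// expr0n mulr0.
  rewrite wE max_l ?mul0r// subr_le0.
  have := vL (y + x) x; rewrite addrK ler_norml => /andP[_ h].
  have : L * `|y| <= L * r by rewrite ler_wpM2l.
  by lra.
Qed.

(** Where [v > d], the point lies in [Omega] and [w] is locally [v - d]; elsewhere [w] attains its
    minimum 0. *)
Lemma gradnorm_truncation (v w : 'rV[R]_n -> R) (L d : R) x :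
  0 <= L -> lipr v L -> (forall x, ~ Omega x -> v x = 0) -> 0 < d ->
  w = (fun x => Num.max 0 (v x - d)) -> differentiable v x ->
  gradnorm w x <= dom_ind x * gradnorm v x.
Proof.
move=> L0 vL vO d0 wE dv; have [dx|xd] := ltP d (v x).
  have Ox : Omega x.
    by apply: contrapT => /vO vx; move: dx; rewrite vx ltNge ltW.
  rewrite (@gradnorm_affine _ _ v w 1 (- d))//.
    by rewrite normr1 /dom_ind; case: asboolP.
  have L1 : 0 < L + 1 by rewrite ltr_wpDl.
  exists ((v x - d) / (L + 1)); first by rewrite divr_gt0// subr_gt0.
  move=> h hh; rewrite wE mul1r max_r// subr_ge0.
  have := vL (x + h) x; rewrite addrAC subrr add0r ler_norml => /andP[h1 _].
  rewrite ltr_pdivlMr// in hh.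
  have : L * `|h| <= `|h| * (L + 1) by rewrite mulrC ler_wpM2l// lerDl.
  by lra.
rewrite gradnorm_min ?mulr_ge0 ?dom_ind_ge0 ?gradnorm_ge0// => y.
by rewrite wE [X in X <= _]max_l ?le_max ?lexx// subr_le0.
Qed.

Lemma le_J_ae (g h : 'rV[R]_n -> R) : bfun g -> bfun h ->
  (forall x, 0 <= g x) -> (forall x, 0 <= h x) ->
  {ae mu R n, forall z, g (vec z) <= h (vec z)} -> J g <= J h.
Proof.
move=> bg bh g0 h0 gh; rewrite -lee_fin !EFin_J//; apply: ae_ge0_le_integral => //.
- by move=> z _; rewrite lee_fin.
- by apply/measurable_EFinP; exact: bg.1.
- by move=> z _; rewrite lee_fin.
- by apply/measurable_EFinP; exact: bh.1.
- by apply: filterS gh => z ? _; rewrite lee_fin.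
Qed.

Lemma bfun_dom_gradnorm v : W1inf0 Omega v -> bfun (fun x => dom_ind x * gradnorm v x).
Proof.
move=> /W1inf0_lipr[L [M [L0 vL vM]]].
by apply: bfunM; [exact: bfun_dom_ind|exact: bfun_gradnorm vL vM].
Qed.

(* The inequality passes from [C10] to Lipschitz functions by mollifying the
   truncations [(v - d)^+], whose support is a compact subset of [Omega]. *)
Lemma poincare_W1inf0 (c : R) v : 0 <= c ->
  (forall phi, C10 Omega phi -> J (fun x => `|phi x|) <= c * J (gradnorm phi)) ->
  W1inf0 Omega v ->
  J (fun x => Num.max 0 (v x)) <= c * J (fun x => dom_ind x * gradnorm v x).
Proof.
move=> c0 hC W; have [L [M [L0 vL vM]]] := W1inf0_lipr W.
have vO := W.2.
have bp := bfun_pos vL vM.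
have bi := bfun_dom_ind.
apply/ler_addgt0Pr => e e0.
have Ji0 : 0 <= J dom_ind by apply: J_ge0; exact: dom_ind_ge0.
have Ji1 : 0 < J dom_ind + 1 by rewrite ltr_wpDl.
(* Truncation lowers the integral of the positive part by at most [d] times the volume of [Omega],
   which is at most [e]. *)
pose d := e / (J dom_ind + 1).
have d0 : 0 < d by rewrite divr_gt0.
pose w x := Num.max 0 (v x - d).
have wL : lipr w L by exact: lipr_pos.
have wM x : M < `|x| -> w x = 0.
  by move=> /vM vx; rewrite /w vx sub0r max_l// oppr_le0 ltW.
have w0 x : 0 <= w x by rewrite /w le_max lexx.
have bw : bfun w by exact: bfun_lipr wL wM.
have L1 : 0 < L + 1 by rewrite ltr_wpDl.
(* Chosen so that [L r <= d / 2], including the case [L = 0]. *)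
pose r := d / 2 / (L + 1).
have r0 : 0 < r by rewrite !divr_gt0.
have Lr : L * r <= d / 2.
  have -> : L * r = d / 2 * (L / (L + 1)) by rewrite /r; ring.
  rewrite -[leRHS]mulr1 ler_wpM2l//; first by rewrite ltW// divr_gt0.
  by rewrite ler_pdivrMr// mul1r lerDl.
pose phi := convol w (moll r).
have phiC : C10 Omega phi by exact: (convol_C10 L0 vL vO vM d0 r0 Lr erefl wL).
have bb := bfun_moll n r0; have b0 := @moll_ge0 R n r.
have bgw : bfun (gradnorm w) by exact: bfun_gradnorm wL wM.
have J0 := J_moll_gt0 n r0.
have phiL : lipr phi (L * J (@moll R n r)).
  move=> x y; rewrite /phi /convol -JB; last 2 first.
  - by apply: bfunM => //; exact: bfun_shift.
  - by apply: bfunM => //; exact: bfun_shift.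
  rewrite mulrAC -JZ//; apply: le_normr_J.
  - by apply: bfunB; apply: bfunM => //; exact: bfun_shift.
  - exact: bfunZ.
  - move=> z; rewrite -mulrBl normrM (ger0_norm (b0 _)) ler_wpM2r//.
    by apply: le_trans (wL _ _) _; rewrite opprD addrACA subrr add0r.
have Jphi : J (fun x => `|phi x|) = J w * J (@moll R n r).
  rewrite -J_conv//; congr J; apply/funext => x; rewrite ger0_norm//.
  by apply: J_ge0 => y; rewrite mulr_ge0.
have Jgrad : J (gradnorm phi) <= J (gradnorm w) * J (@moll R n r).
  have gw0 x : 0 <= gradnorm w x by exact: gradnorm_ge0.
  rewrite -J_conv//; have [_ [N [_ hN]]] := bfun_conv bw bb w0 b0.
  apply: le_J; [exact: bfun_gradnorm phiL hN|exact: bfun_conv|] => x.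
  exact: (gradnorm_convol_le L0 wL wM bb b0 (conv_moll_grad r0 wL wM w0 x)).
have Jw : J w <= c * J (fun x => dom_ind x * gradnorm v x).
  apply: (@le_trans _ _ (c * J (gradnorm w))).
    (* Multiplying by the mass of the kernel turns both sides into quantities of the mollified
       function. *)
    rewrite -(ler_pM2r J0) -Jphi -mulrA.
    by apply: le_trans (hC _ phiC) _; rewrite ler_wpM2l.
  rewrite ler_wpM2l//; apply: le_J_ae => //.
  - exact: bfun_dom_gradnorm.
  - by move=> x; exact: gradnorm_ge0.
  - by move=> x; rewrite mulr_ge0 ?dom_ind_ge0 ?gradnorm_ge0.
  - apply: filterS (ae_differentiable vL) => z dz.
    exact: (gradnorm_truncation L0 vL vO d0 erefl dz).
apply: (@le_trans _ _ (J (fun x => w x + d * dom_ind x))).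
  apply: le_J => //; first by apply: bfunD => //; exact: bfunZ.
  move=> x; rewrite /dom_ind; case: asboolP => [_|/vO vx].
    rewrite mulr1 /w ge_max addr_ge0 ?(ltW d0) ?le_max ?lexx//=.
    by rewrite -lerBlDr le_max lexx orbT.
  by rewrite vx maxxx mulr0 addr0.
rewrite JD//; last exact: bfunZ.
rewrite JZ// lerD// /d mulrAC ler_pdivrMr// ler_wpM2l ?(ltW e0)//.
by rewrite lerDl.
Qed.

End sobolev_approximation.

(** * The energy *)

Section C10_functions.
Variables (R : realType) (n : nat) (Omega : set 'rV[R]_n).

Lemma is_derive_line (u : 'rV[R]_n -> R) x k s q :
  has_grad u (x + s *: k) q -> is_derive s 1 (fun t => u (x + t *: k)) (dotr q k).
Proof.
move=> hq.
have c : (fun h : R => h^-1 *: (u (x + (h *: 1 + s) *: k) - u (x + s *: k))) @ 0^' -->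
    dotr q k.
  apply/cvgrPdist_le => e e0.
  have k0 : 0 < `|k| + 1 by rewrite ltr_wpDl.
  have [|d [d0 hd]] := hq (e / (`|k| + 1)); first by rewrite divr_gt0.
  apply/nbhs_ballP; exists (d / (`|k| + 1)); first by rewrite /= divr_gt0.
  move=> h; rewrite /ball/= sub0r normrN ltr_pdivlMr// => hh h0.
  have hk : `|h *: k| < d.
    by rewrite normrZ (le_lt_trans _ hh)// ler_wpM2l// lerDl.
  have -> : x + (h *: 1 + s) *: k = x + s *: k + h *: k.
    by rewrite [h *: 1]mulr1 scalerDl (addrC (h *: k)) addrA.
  have := hd _ hk; rewrite normrZ dotrZr.
  move: (u (x + s *: k + h *: k) - _) => a ha.
  rewrite -(ler_pM2l (_ : 0 < `|h|)) ?normr_gt0// -normrM mulrBr.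
  rewrite [h * (h^-1 *: a)]mulrA divff// mul1r distrC; apply: le_trans ha _.
  rewrite mulrCA ler_wpM2l// -[leRHS]mulr1 -mulrA ler_wpM2l ?(ltW e0)//.
  by rewrite mulrC ler_pdivrMr// mul1r lerDl.
apply: DeriveDef; first by apply/cvg_ex; exists (dotr q k).
by apply: cvg_lim => //; exact: Rhausdorff.
Qed.

Lemma C10_supp phi : C10 Omega phi -> exists K, [/\ compact K, K `<=` Omega,
  forall x, ~ K x -> phi x = 0 & forall x, ~ K x -> has_grad phi x 0].
Proof.
move=> [_ [_ [K [cK [KO K0]]]]]; exists K; split=> // x nKx e e0.
have oK : open (~` K) by apply: closed_openC; apply: compact_closed => //; exact: norm_hausdorff.
have /nbhs_ballP[d /= d0 hd] : nbhs x (~` K) by exact: open_nbhs_nbhs.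
exists d; split=> // h hh.
have xh : ~ K (x + h).
  by apply: hd; rewrite -ball_normE/= opprD addrA subrr sub0r normrN.
rewrite !K0// /dotr big1 => [|i _]; last by rewrite mxE mul0r.
by rewrite !subrr normr0 mulr_ge0// ltW.
Qed.

(** The partial derivatives are continuous, hence bounded on the compact set, and vanish off it; the
    mean value theorem along segments concludes. *)
Lemma C10_lipr phi : C10 Omega phi -> exists L, 0 <= L /\ lipr phi L.
Proof.
move=> C; have [K [cK _ _ gK]] := C10_supp C; have [dphi [cp _]] := C.
have hB i : exists B : R, forall x, `|partial phi i x| <= B.
  have [M [_ hM]] : bounded_set (partial phi i @` K).
    apply: compact_bounded; apply: continuous_compact => //.
    exact: continuous_subspaceT.
  exists (`|M| + 1) => x; have [Kx|/gK/has_grad_partial] := pselect (K x).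
    by apply: (hM (`|M| + 1)); [rewrite (le_lt_trans (ler_norm _))// ltrDl|exists x].
  by move=> /rowP/(_ i); rewrite !mxE => ->; rewrite normr0 addr_ge0.
have [B hB'] := choice hB.
pose S := \sum_i B i.
have B0 i : 0 <= B i by apply: le_trans (hB' i 0).
have hS i x : `|partial phi i x| <= S.
  apply: le_trans (hB' i x) _; rewrite /S (bigD1 i)//= lerDl.
  by apply: sumr_ge0 => j _; exact: B0.
have S0 : 0 <= S by apply: sumr_ge0 => j _; exact: B0.
exists (n%:R * S); split=> [|y x]; first by rewrite mulr_ge0.
pose k := y - x.
have dg (s : R) : is_derive s 1 (fun t : R => phi (x + t *: k))
    (dotr (\row_i partial phi i (x + s *: k)) k).
  by apply: is_derive_line; exact: diff_has_grad.
have cg : {within `[0, 1], continuous (fun t : R => phi (x + t *: k))}.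
  by apply: derivable_within_continuous => t _; exact: (@ex_derive _ _ _ _ _ _ _ (dg t)).
have [s _] := MVT ltr01 (fun t _ => dg t) cg.
have -> : x + 1 *: k = y by rewrite scale1r /k addrC subrK.
rewrite scale0r addr0 subr0 mulr1 => ->.
by apply: le_dotr => i; rewrite mxE.
Qed.

End C10_functions.

Section energy.
Variables (R : realType) (n : nat) (Omega : set 'rV[R]_n) (f : R -> R).
Hypothesis OmegaD : bounded_domain Omega.
Hypothesis f_nd : forall x y, 0 <= x -> x <= y -> f x <= f y.
Hypothesis f0 : f 0 = 0.

Lemma bfun_f_gradnorm v : W1inf0 Omega v -> bfun (fun x => f (gradnorm v x)).
Proof.
move=> /(W1inf0_lipr OmegaD)[L [M [L0 vL vM]]]; have [mg [N [gN g0]]] := bfun_gradnorm vL vM.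
(* Monotonicity of [f] is given on the half-line only; composing with [Num.max 0] yields a monotone,
   hence measurable, function on the whole line. *)
have fmax x : f (gradnorm v x) = f (Num.max 0 (gradnorm v x)).
  by rewrite max_r// gradnorm_ge0.
split.
  have -> : (fun x => f (gradnorm v x)) \o @vec R n =
      (fun s => f (Num.max 0 s)) \o (gradnorm v \o @vec R n).
    by apply/funext => z /=; rewrite fmax.
  apply: measurableT_comp mg; apply: nondecreasing_measurable => //.
  move=> s t st; apply: f_nd; first by rewrite le_max lexx.
  by rewrite ge_max !le_max lexx st orbT.
exists (Num.max N (f (n%:R * L))); split=> [x|x]; last first.
  by rewrite gt_max => /andP[Nx _]; rewrite g0.
have fp : 0 <= f (gradnorm v x) by rewrite -f0; apply: f_nd => //; exact: gradnorm_ge0.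
rewrite ger0_norm// le_max; apply/orP; right.
by apply: f_nd; [exact: gradnorm_ge0|exact: lipr_gradnorm_le].
Qed.

(** As [v] vanishes off [Omega], its own integral loses the indicator. The gradient term keeps it,
    since a gradient may survive at a boundary point. *)
Lemma I_OmegaE v : W1inf0 Omega v ->
  I_Omega f Omega v = (J (fun x => dom_ind Omega x * f (gradnorm v x)) - J v)%:E.
Proof.
move=> W; have bi := bfun_dom_ind OmegaD; have bf := bfun_f_gradnorm W.
have [L [M [L0 vL vM]]] := W1inf0_lipr OmegaD W.
have bv : bfun v by exact: bfun_lipr vL vM.
have E : (fun x => dom_ind Omega x * (f (gradnorm v x) - v x)) =
    (fun x => dom_ind Omega x * f (gradnorm v x) - v x).
  apply/funext => x; rewrite mulrBr; congr (_ - _); rewrite /dom_ind.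
  by case: asboolP => [_|/(W.2) ->]; rewrite ?mul1r// mulr0.
have bif : bfun (fun x => dom_ind Omega x * f (gradnorm v x)) by exact: bfunM.
by rewrite /I_Omega integral_onE// E ?JB//; exact: bfunB.
Qed.

Lemma I_Omega0 v : (forall x, v x = 0) -> I_Omega f Omega v = 0%E.
Proof.
move=> v0; have W : W1inf0 Omega v.
  by split=> [|x _]//; exists 0 => x y; rewrite !v0 subrr normr0 mul0r.
have g0 x : gradnorm v x = 0.
  by apply: (@gradnorm_locally_cst _ _ _ 0); exists 1 => // h _; rewrite v0.
rewrite I_OmegaE// (_ : (fun x => _) = fun=> 0); last first.
  by apply/funext => x; rewrite g0 f0 mulr0.
by rewrite (_ : v = fun=> 0) ?J0 ?subrr//; apply/funext.
Qed.

End energy.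

(** * The integrand and its tangent at 0 *)

Section integrand.
Variables (R : realType) (f f1 f2 : R -> R).
Hypothesis f_der : forall s : R, 0 < s -> is_derive s 1 f (f1 s).
Hypothesis f_der0 : ((fun h : R => h^-1 * (f h - f 0)) @ 0^'+) --> f1 0.
Hypothesis f1_cont : {within `[0, +oo[, continuous f1}.
Hypothesis f_convex : forall x y t, 0 <= x -> 0 <= y -> 0 <= t <= 1 ->
  f (t * x + (1 - t) * y) <= t * f x + (1 - t) * f y.
Hypothesis f0 : f 0 = 0.
Hypothesis f1_der : forall s : R, 0 < s -> is_derive s 1 f1 (f2 s).
Hypothesis f2_gt0 : forall s, 0 < s -> 0 < f2 s.

Lemma convex_scale (t s : R) : 0 <= s -> 0 <= t <= 1 -> f (t * s) <= t * f s.
Proof.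
move=> s0 t01; have := f_convex s0 (lexx 0) t01.
by rewrite f0 !mulr0 !addr0.
Qed.

Lemma slope_near0 (e b : R) : 0 < e -> 0 < b ->
  exists h, [/\ 0 < h, h < b & `|f1 0 - h^-1 * f h| <= e].
Proof.
move=> e0 b0; move/cvgrPdist_le : f_der0 => /(_ e e0); rewrite f0 => H.
near (0 : R)^'+ => h; exists h; split.
- by near: h; exact: nbhs_right_gt.
- by near: h; exact: nbhs_right_lt.
- rewrite -[f h]subr0; near: h; exact: H.
Unshelve. all: by end_near. Qed.

(** By convexity and [f 0 = 0], the slope [f h / h] is at most [f s / s] for [h < s]; the limit for
    small [h] is [f1 0]. *)
Lemma tangent_le s : 0 <= s -> f1 0 * s <= f s.
Proof.
rewrite le_eqVlt => /predU1P[<-|s0]; first by rewrite mulr0 f0.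
rewrite -ler_pdivlMr//; apply/ler_addgt0Pr => e e0.
have [h [h0 hs he]] := slope_near0 e0 s0.
have hs1 : 0 <= h / s <= 1.
  by rewrite divr_ge0 ?(ltW h0) ?(ltW s0)//= ler_pdivrMr// mul1r ltW.
have := convex_scale (ltW s0) hs1; rewrite divfK ?gt_eqF// => h1.
have h2 : h^-1 * f h <= f s / s.
  rewrite mulrC ler_pdivrMr//; apply: le_trans h1 _.
  by rewrite le_eqVlt; apply/orP; left; apply/eqP; ring.
move: he; rewrite ler_norml => /andP[_]; lra.
Qed.

(** The weak inequality is used up to [s / 2]; on [[s / 2, s]] the mean slope is some [f1 c], which
    exceeds [f1 0] because [f2] is positive. Starting at [s / 2] keeps the interval inside the
    region where [f] is differentiable. *)
Lemma tangent_lt s : 0 < s -> f1 0 * s < f s.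
Proof.
move=> s0; have s2 : 0 < s / 2 by rewrite divr_gt0.
have s2s : s / 2 < s by rewrite ltr_pdivrMr// ltr_pMr// ltr1n.
have cf : {within `[s / 2, s], continuous f}.
  apply: derivable_within_continuous => t; rewrite in_itv/= => /andP[st _].
  exact: (@ex_derive _ _ _ _ _ _ _ (f_der (lt_le_trans s2 st))).
have df t : t \in `](s / 2), s[ -> is_derive t 1 f (f1 t).
  by rewrite in_itv/= => /andP[st _]; apply: f_der; exact: lt_trans st.
have [c] := MVT s2s df cf; rewrite in_itv/= => /andP[sc _] fE.
have c0 : 0 < c by exact: lt_trans sc.
have cf1 : {within `[0, c], continuous f1}.
  apply: continuous_subspaceW f1_cont => t /=; rewrite !in_itv/= => /andP[->] //.
have df1 t : t \in `]0, c[ -> is_derive t 1 f1 (f2 t).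
  by rewrite in_itv/= => /andP[t0 _]; exact: f1_der.
have [b] := MVT c0 df1 cf1; rewrite in_itv/= => /andP[b0 _] f1E.
have f1c : f1 0 < f1 c.
  by rewrite -subr_gt0 f1E subr0 mulr_gt0// f2_gt0.
have h := tangent_le (ltW s2).
have h2 : f1 0 * (s - s / 2) < f1 c * (s - s / 2) by rewrite ltr_pM2r// subr_gt0.
by rewrite -fE in h2; lra.
Qed.

End integrand.

(** * The Cheeger constant as a best constant *)

Section cheeger.
Variables (R : realType) (n : nat) (Omega : set 'rV[R]_n).
Hypothesis OmegaD : bounded_domain Omega.

Lemma C10_bfun phi : C10 Omega phi ->
  [/\ bfun phi, bfun (fun x => `|phi x|) & bfun (gradnorm phi)].
Proof.
move=> C; have [L [L0 pL]] := C10_lipr C; have [K [_ KO K0 _]] := C10_supp C.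
have [M hM] := dom_bounded OmegaD.
have pM x : M < `|x| -> phi x = 0 by move=> /hM nO; apply: K0 => /KO.
split; [exact: bfun_lipr pL pM| |exact: bfun_gradnorm pL pM].
apply: (@bfun_lipr _ _ _ L M) => [x y|x /pM ->]; last by rewrite normr0.
exact: le_trans (ler_dist_dist _ _) (pL x y).
Qed.

Lemma C10_dom_ind phi : C10 Omega phi ->
  (fun x => dom_ind Omega x * `|phi x|) = (fun x => `|phi x|) /\
  (fun x => dom_ind Omega x * gradnorm phi x) = gradnorm phi.
Proof.
move=> C; have [K [_ KO K0 gK]] := C10_supp C.
split; apply/funext => x; rewrite /dom_ind; case: asboolP => [_|nO];
  rewrite ?mul1r// mul0r.
- by rewrite K0 ?normr0// => /KO.
- rewrite (gradnormE (gK x _)) => [|/KO//].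
  by rewrite /enorm big1 ?sqrtr0// => i _; rewrite mxE expr0n.
Qed.

Lemma cheeger_ratioE phi : C10 Omega phi ->
  ((fine (integral_on Omega (gradnorm phi)) /
    fine (integral_on Omega (fun x => `|phi x|)))%:E =
  (J (gradnorm phi) / J (fun x => `|phi x|))%:E)%E.
Proof.
move=> C; have [e1 e2] := C10_dom_ind C; have [_ b1 b2] := C10_bfun C.
by rewrite !integral_onE ?e1 ?e2.
Qed.

Lemma C10_J_gt0 phi : C10 Omega phi -> (exists x, phi x != 0) ->
  0 < J (fun x => `|phi x|).
Proof.
move=> C [x px]; have [_ b1 _] := C10_bfun C; have [L [_ pL]] := C10_lipr C.
apply: J_gt0 => //; last by exists x; rewrite normr_eq0.
exact: (continuous_normf (lipr_continuous pL)).
Qed.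

(** For nonzero [phi] the denominator is positive, so a lower bound on the infimum can be cleared of
    fractions quotient by quotient; for [phi = 0] the inequality is trivial. *)
Lemma cheegerP (c : R) : 0 < c ->
  (1 <= c%:E * cheeger Omega)%E <->
  (forall phi, C10 Omega phi -> J (fun x => `|phi x|) <= c * J (gradnorm phi)).
Proof.
move=> c0; split=> [h phi C|h].
  have [[x px]|nx] := pselect (exists x, phi x != 0); last first.
    have p0 : (fun x => `|phi x|) = fun=> 0.
      apply/funext => x; apply/eqP; rewrite normr_eq0; apply/negPn/negP => px.
      by apply: nx; exists x.
    rewrite p0 J0 mulr_ge0 ?(ltW c0)//; apply: J_ge0 => x; exact: gradnorm_ge0.
  have Jp : 0 < J (fun x => `|phi x|) by apply: C10_J_gt0 => //; exists x.
  have : (cheeger Omega <= (J (gradnorm phi) / J (fun x => `|phi x|))%:E)%E.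
    by apply: ereal_inf_lbound; exists phi; [split=> //; exists x|exact: cheeger_ratioE].
  move=> hr; have := le_trans h (lee_wpmul2l (_ : (0 <= c%:E)%E) hr).
  rewrite lee_fin (ltW c0) => /(_ isT); rewrite -EFinM lee_fin mulrA.
  by rewrite ler_pdivlMr// mul1r.
have : ((c^-1)%:E <= cheeger Omega)%E.
  apply: le_ereal_inf_tmp => _ [phi [C nz] <-].
  rewrite cheeger_ratioE// lee_fin ler_pdivlMr ?C10_J_gt0//.
  by rewrite mulrC ler_pdivrMr// mulrC; exact: h.
move=> /(lee_wpmul2l (_ : (0 <= c%:E)%E)); rewrite lee_fin (ltW c0) => /(_ isT).
by rewrite -EFinM divff// gt_eqF.
Qed.

(* Outside the zero set [|phi|] is locally [phi] or [- phi]; on the zero set it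
   is minimal, so its gradient, if any, vanishes. *)
Lemma gradnorm_abs_le (phi : 'rV[R]_n -> R) (L t : R) x : 0 <= L -> lipr phi L -> 0 <= t ->
  differentiable phi x -> gradnorm (fun y => t * `|phi y|) x <= t * gradnorm phi x.
Proof.
move=> L0 pL t0 dx; have L1 : 0 < L + 1 by rewrite ltr_wpDl.
have [px|px] := eqVneq (phi x) 0.
  rewrite gradnorm_min ?mulr_ge0 ?gradnorm_ge0// => y.
  by rewrite px normr0 mulr0 mulr_ge0.
rewrite (@gradnorm_affine _ _ phi _ (t * Num.sg (phi x)) 0)//.
  by rewrite normrM (ger0_norm t0) normr_sg px mulr1.
exists (`|phi x| / (L + 1)); first by rewrite divr_gt0// normr_gt0.
move=> h; rewrite ltr_pdivlMr// => hh; rewrite addr0 -mulrA; congr (_ * _).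
have := pL (x + h) x; rewrite addrAC subrr add0r.
have : L * `|h| <= `|h| * (L + 1) by rewrite mulrC ler_wpM2l// lerDl.
move=> h1 h2; have {h1 h2}h3 := le_lt_trans (le_trans h2 h1) hh.
have [p0|p0|p0] := ltgtP (phi x) 0; last by rewrite p0 eqxx in px.
- rewrite ltr0_sg// mulN1r ltr0_norm//; rewrite (ltr0_norm p0) ltr_norml in h3.
  by move: h3 => /andP[_]; lra.
- rewrite gtr0_sg// mul1r gtr0_norm//; rewrite (gtr0_norm p0) ltr_norml in h3.
  by move: h3 => /andP[+ _]; lra.
Qed.

End cheeger.

(** * Nonnegative energy and vanishing minimizers *)

Section minimizers.
Variables (R : realType) (n : nat) (Omega : set 'rV[R]_n) (f f1 f2 : R -> R).
Hypothesis OmegaD : bounded_domain Omega.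
Hypothesis f_der : forall s : R, 0 < s -> is_derive s 1 f (f1 s).
Hypothesis f_der0 : ((fun h : R => h^-1 * (f h - f 0)) @ 0^'+) --> f1 0.
Hypothesis f1_cont : {within `[0, +oo[, continuous f1}.
Hypothesis f_convex : forall x y t, 0 <= x -> 0 <= y -> 0 <= t <= 1 ->
  f (t * x + (1 - t) * y) <= t * f x + (1 - t) * f y.
Hypothesis f_nd : forall x y, 0 <= x -> x <= y -> f x <= f y.
Hypothesis f0 : f 0 = 0.
Hypothesis f10 : 0 < f1 0.
Hypothesis f1_der : forall s : R, 0 < s -> is_derive s 1 f1 (f2 s).
Hypothesis f2_gt0 : forall s, 0 < s -> 0 < f2 s.

(* Test the nonnegativity of the energy on [t |phi|] and let [t] tend to 0. *)
Lemma energy_ge0_poincare :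
  (forall v, W1inf0 Omega v -> (0 <= I_Omega f Omega v)%E) ->
  forall phi, C10 Omega phi -> J (fun x => `|phi x|) <= f1 0 * J (gradnorm phi).
Proof.
move=> I0 phi C; have [L [L0 pL]] := C10_lipr C.
have [K [_ KO K0 _]] := C10_supp C.
have [_ ba bg] := C10_bfun OmegaD C.
have Jg0 : 0 <= J (gradnorm phi) by apply: J_ge0 => x; exact: gradnorm_ge0.
pose B := n%:R * L + 1.
have B0 : 0 < B by rewrite ltr_wpDl// mulr_ge0.
have gB x : gradnorm phi x <= B.
  by rewrite (le_trans (lipr_gradnorm_le x L0 pL))// lerDl.
apply/ler_addgt0Pr => e e0.
have J1 : 0 < J (gradnorm phi) + 1 by rewrite ltr_wpDl.
have e1 : 0 < e / (J (gradnorm phi) + 1) by rewrite divr_gt0.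
have [h [h0 _ he]] := slope_near0 f_der0 f0 e1 ltr01.
set d := e / _ in e1 he.
have fh : f h <= (f1 0 + d) * h.
  rewrite -ler_pdivrMr// mulrC; move: he; rewrite ler_norml => /andP[+ _]; lra.
(* As [B] bounds [gradnorm phi], the number [t * gradnorm phi x] is [h] times a factor in [[0, 1]].
   Convexity then reduces [f] at this point to [f h], which is at most [(f1 0 + d) h]. *)
pose t := h / B; have t0 : 0 < t by rewrite divr_gt0.
pose v x := t * `|phi x|.
have vW : W1inf0 Omega v.
  split=> [|x nO]; last by rewrite /v K0 ?normr0 ?mulr0// => /KO.
  apply: (@lipr_lipschitz _ _ _ (t * L)) => x y.
  rewrite -mulrBr normrM (gtr0_norm t0) -(mulrA t) ler_wpM2l ?(ltW t0)//.
  exact: le_trans (ler_dist_dist _ _) (pL x y).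
have bf := bfun_f_gradnorm OmegaD f_nd f0 vW; have bi := bfun_dom_ind OmegaD.
have fv x : dom_ind Omega x * f (gradnorm v x) <= (f1 0 + d) * t * gradnorm phi x.
  have g0 := gradnorm_ge0 phi x.
  have fp s : 0 <= s -> 0 <= f s by move=> s0; rewrite -f0; exact: f_nd.
  apply: (@le_trans _ _ (f (gradnorm v x))).
    rewrite /dom_ind; case: ifP => _; rewrite ?mul1r// mul0r.
    by apply: fp; exact: gradnorm_ge0.
  apply: (@le_trans _ _ (f (t * gradnorm phi x))).
    apply: f_nd; first exact: gradnorm_ge0.
    exact: (gradnorm_abs_le L0 pL (ltW t0) (C.1 x)).
  have gB1 : 0 <= gradnorm phi x / B <= 1.
    by rewrite divr_ge0 ?(ltW B0)//= ler_pdivrMr// mul1r.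
  have -> : t * gradnorm phi x = gradnorm phi x / B * h by rewrite /t; ring.
  apply: le_trans (convex_scale f_convex f0 (ltW h0) gB1) _.
  have -> : (f1 0 + d) * t * gradnorm phi x = gradnorm phi x / B * ((f1 0 + d) * h).
    by rewrite /t; ring.
  by rewrite ler_wpM2l// divr_ge0 ?(ltW B0).
have := I0 _ vW; rewrite (I_OmegaE OmegaD f_nd f0 vW) lee_fin subr_ge0 /v JZ// => h1.
have h2 : t * J (fun x => `|phi x|) <= (f1 0 + d) * t * J (gradnorm phi).
  apply: le_trans h1 _; rewrite -JZ//; apply: le_J => //; last exact: bfunZ.
  exact: bfunM.
have h3 : J (fun x => `|phi x|) <= (f1 0 + d) * J (gradnorm phi).
  rewrite -(ler_pM2l t0); apply: le_trans h2 _.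
  by rewrite le_eqVlt; apply/orP; left; apply/eqP; ring.
apply: le_trans h3 _; rewrite mulrDl lerD2l /d mulrAC ler_pdivrMr//.
by rewrite ler_wpM2l ?(ltW e0)// lerDl.
Qed.

Lemma W1inf0_bfun v : W1inf0 Omega v -> bfun v /\ continuous v.
Proof.
move=> /(W1inf0_lipr OmegaD)[L [M [L0 vL vM]]].
by split; [exact: bfun_lipr vL vM|exact: lipr_continuous vL].
Qed.

Lemma W1inf0N v : W1inf0 Omega v -> W1inf0 Omega (fun x => - v x).
Proof.
move=> [[L vL] v0]; split=> [|x /v0 ->]; last by rewrite oppr0.
by exists L => x y; rewrite -opprD normrN.
Qed.

Lemma gradnormN (v : 'rV[R]_n -> R) x : gradnorm (fun y => - v y) x = gradnorm v x.
Proof.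
have aff (w : 'rV[R]_n -> R) : exists2 d : R, 0 < d &
    forall h, `|h| < d -> - w (x + h) = -1 * w (x + h) + 0.
  by exists 1 => // h _; rewrite mulN1r addr0.
have [dv|nv] := pselect (differentiable v x).
  by rewrite (gradnorm_affine (aff v) dv) normrN normr1 mul1r.
rewrite !gradnorm_ndiff// => /diff_has_grad hq; apply: nv.
have affN : exists2 d : R, 0 < d &
    forall h, `|h| < d -> v (x + h) = -1 * - v (x + h) + 0.
  by exists 1 => // h _; rewrite mulN1r opprK addr0.
exact: (has_grad_diff (has_grad_affine affN hq)).1.
Qed.

(** The inequality makes the integral of the positive part of [v] vanish, and a continuous
    nonnegative function with zero integral is 0 everywhere. *)
Lemma gradient_integral0 v : W1inf0 Omega v ->
  (forall phi, C10 Omega phi -> J (fun x => `|phi x|) <= f1 0 * J (gradnorm phi)) ->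
  J (fun x => dom_ind Omega x * gradnorm v x) = 0 -> forall x, v x <= 0.
Proof.
move=> W hC J0v x; rewrite leNgt; apply/negP => vx.
have [bv cv] := W1inf0_bfun W.
have [L [M [L0 vL vM]]] := W1inf0_lipr OmegaD W.
have := poincare_W1inf0 OmegaD (ltW f10) hC W; rewrite J0v mulr0 leNgt => /negP; apply.
apply: J_gt0.
- exact: bfun_pos vL vM.
- by apply: continuous_maxf => //; exact: cst_continuous.
- by move=> y; rewrite le_max lexx.
- by exists x; rewrite gt_eqF// lt_max vx orbT.
Qed.

Lemma minimizer_eq0 u : W1inf0 Omega u -> (I_Omega f Omega u <= 0)%E ->
  (forall phi, C10 Omega phi -> J (fun x => `|phi x|) <= f1 0 * J (gradnorm phi)) ->
  forall x, u x = 0.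
Proof.
move=> W Iu hC; have [bu cu] := W1inf0_bfun W.
have bi := bfun_dom_ind OmegaD.
have bf : bfun (fun x => dom_ind Omega x * f (gradnorm u x)).
  exact: (bfunM bi (bfun_f_gradnorm OmegaD f_nd f0 W)).
have bg := bfun_dom_gradnorm OmegaD W.
have tl := tangent_le f_der0 f_convex f0.
have tlt := tangent_lt f_der f_der0 f1_cont f_convex f0 f1_der f2_gt0.
(* The excess of the integrand over its tangent at 0; it is nonnegative, and positive at points of
   [Omega] with nonzero gradient. *)
pose G x := dom_ind Omega x * f (gradnorm u x) -
  f1 0 * (dom_ind Omega x * gradnorm u x).
have bG : bfun G by apply: bfunB => //; exact: bfunZ.
have GE x : G x = dom_ind Omega x * (f (gradnorm u x) - f1 0 * gradnorm u x).
  by rewrite /G; ring.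
have G0 x : 0 <= G x.
  rewrite GE mulr_ge0 ?dom_ind_ge0// subr_ge0; apply: tl; exact: gradnorm_ge0.
(* The integral of [f (gradnorm u)] over [Omega] is at most that of [u], hence of its positive part,
   hence at most [f1 0] times the integral of [gradnorm u] over [Omega]. *)
have JG : J G = 0.
  apply/eqP; rewrite eq_le (J_ge0 G0) andbT JB//; last exact: bfunZ.
  rewrite JZ// subr_le0; move: Iu.
  rewrite (I_OmegaE OmegaD f_nd f0 W) lee_fin subr_le0 => h; apply: le_trans h _.
  apply: le_trans (poincare_W1inf0 OmegaD (ltW f10) hC W).
  have [L [M [L0 vL vM]]] := W1inf0_lipr OmegaD W.
  apply: le_J => //; last by move=> x; rewrite le_max lexx orbT.
  exact: bfun_pos vL vM.
have Jg : J (fun x => dom_ind Omega x * gradnorm u x) = 0.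
  apply/eqP; rewrite eq_le; apply/andP; split; last first.
    by apply: J_ge0 => x; rewrite mulr_ge0 ?dom_ind_ge0 ?gradnorm_ge0.
  rewrite -(J0 R n); apply: le_J_ae => //.
  - exact: bfun0.
  - by move=> x; rewrite mulr_ge0 ?dom_ind_ge0 ?gradnorm_ge0.
  have mG : measurable_fun setT (fun z => (G (vec z))%:E).
    by apply/measurable_EFinP; exact: bG.1.
  have /(ae_eq_integral_abs _ measurableT mG) : (\int[mu R n]_z `|(G (vec z))%:E| = 0)%E.
    under eq_integral do rewrite gee0_abs ?lee_fin//.
    by rewrite -EFin_J// JG.
  apply: filterS => z /(_ I) [Gz].
  rewrite leNgt; apply/negP => gz.
  have : 0 < G (vec z).
    move: gz; rewrite GE /dom_ind; case: ifP => _; rewrite ?mul0r ?ltxx// !mul1r => gz.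
    by rewrite subr_gt0; exact: tlt.
  by rewrite Gz ltxx.
move=> x; apply/eqP; rewrite eq_le (gradient_integral0 W hC Jg)/=.
(* For [- u] no minimality is used, only that its gradient has the same norm. *)
have WN := W1inf0N W.
have JgN : J (fun x => dom_ind Omega x * gradnorm (fun y => - u y) x) = 0.
  by rewrite -Jg; congr J; apply/funext => y; rewrite gradnormN.
by have := gradient_integral0 WN hC JgN x; rewrite oppr_le0.
Qed.

End minimizers.

Theorem theorem3p2 (R : realType) (N : nat) (Omega : set 'rV[R]_N)
  (f f1 f2 : R -> R) (u : 'rV[R]_N -> R) :
  (0 < N)%N ->
  bounded_domain Omega ->
  (* (f1): f in C^1([0,oo)) with derivative f1 (right derivative at 0) *)
  (forall s : R, 0 < s -> is_derive s 1 f (f1 s)) ->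
  ((fun h : R => h^-1 * (f h - f 0)) @ 0^'+) --> f1 0 ->
  {within `[0, +oo[, continuous f1} ->
  (* f convex on [0,oo) *)
  (forall x y t, 0 <= x -> 0 <= y -> 0 <= t <= 1 ->
     f (t * x + (1 - t) * y) <= t * f x + (1 - t) * f y) ->
  (* f monotone nondecreasing on [0,oo) *)
  (forall x y, 0 <= x -> x <= y -> f x <= f y) ->
  f 0 = 0 ->
  ((fun s : R => f s / s) @ +oo --> +oo) ->
  (* (f3) *)
  0 < f1 0 ->
  (forall s : R, 0 < s -> is_derive s 1 f1 (f2 s)) ->
  (exists alpha : R, 0 < alpha < 1 /\
     forall a b, 0 < a -> a <= b -> exists C : R, forall x y,
       a <= x <= b -> a <= y <= b -> `|f2 x - f2 y| <= C * (`|x - y| `^ alpha)) ->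
  (forall s, 0 < s -> 0 < f2 s) ->
  (* u is the minimizer of I_Omega over W^{1,oo}_0(Omega) *)
  W1inf0 Omega u ->
  (forall v, W1inf0 Omega v -> (I_Omega f Omega u <= I_Omega f Omega v)%E) ->
  (forall x, Omega x -> u x = 0) <-> (1 <= (f1 0)%:E * cheeger Omega)%E.
Proof.
move=> _ OmegaD f_der f_der0 f1_cont f_convex f_nd f0 _ f10 f1_der _ f2_gt0 W umin.
rewrite (cheegerP OmegaD f10); split=> [u0|hC].
  have u00 x : u x = 0 by have [/u0|/(W.2)] := pselect (Omega x).
  apply: (energy_ge0_poincare OmegaD f_der0 f_convex f_nd f0) => v Wv.
  by rewrite -(I_Omega0 OmegaD f_nd f0 u00); exact: umin.
have Iu : (I_Omega f Omega u <= 0)%E.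
  rewrite -(@I_Omega0 _ _ Omega f OmegaD f_nd f0 (fun=> 0))//; apply: umin.
  by split=> //; exists 0 => x y; rewrite subrr normr0 mul0r.
by move=> x _; exact: (minimizer_eq0 OmegaD f_der f_der0 f1_cont f_convex f_nd f0 f10
  f1_der f2_gt0 W Iu hC).
Qed.
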